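(* Let $\Omega$ be a Boolean algebra and $\mathcal{A}$ a Banach $2$-space. For sheaves $\xi\in\mathbf{Shv}(\Omega)$ and cosheaves $\mu,\nu\in\mathbf{CoShv}(\Omega,\mathcal{A})$ there is a natural isometric isomorphism $$\mathbf{CoShv}\Bigl(\int\xi\,\mathrm{d}\mu,\ \nu\Bigr)\cong\mathbf{Shv}\bigl(\xi,\ \mathbf{CoShv}(\mu,\nu)\bigr),$$ where on the right-hand side $\mathbf{CoShv}(\mu,\nu)$ denotes the hom-sheaf on $\Omega$ of cosheaf maps $\mu\to\nu$, and $\int\xi\,\mathrm{d}\mu$ is the indefinite integral cosheaf of $\xi$ against $\mu$.
   Context: A Banach category is a category enriched in $\mathbf{Ban}_c$ (Banach spaces over $\mathbb{K}$ and linear contractions, with projective tensor product); functors are enriched (contractive) and natural transformations are uniformly bounded, with sup norm. A Banach $2$-space is a Banach category with all small enriched colimits. $\mathbf{Ban}$ is the Banach category of Banach spaces and bounded linear maps. $\Omega$ is viewed as a category with an arrow $E\to F$ iff $E\subseteq F$; functors on it send arrows to contractions. A finite partition of $E$ is a finite family of pairwise disjoint non-zero elements with supremum $E$ (the empty family partitions $0$). $\mathbf{PShv}(\Omega)$ is the category of functors $\Omega^{\mathrm{op}}\to\mathbf{Ban}$; $\mathbf{Shv}(\Omega)$ is the full subcategory of sheaves for the finite topology, i.e. those $\xi$ such that for each finite partition $(E_n)$ of any $E$ the restrictions give an isometric isomorphism $\xi(E)\cong\prod_n\xi(E_n)$ (sup norm). Sheafification $r\colon\mathbf{PShv}(\Omega)\to\mathbf{Shv}(\Omega)$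 is the left adjoint of the inclusion. $\mathbf{Shv}(\Omega)$ is monoidal with $\otimes$ the sheafification of the pointwise projective tensor product. $Y(E)$ is the presheaf with value $\mathbb{K}$ at $F\subseteq E$ and $0$ otherwise, and $\chi(E)=rY(E)$. A cosheaf is a functor $\mu\colon\Omega\to\mathcal{A}$ such that for each finite partition $(E_n)$ of any $E$ the canonical map $\sum_n\mu(E_n)\to\mu(E)$ from the coproduct is an isometric isomorphism; $\mathbf{CoShv}(\Omega,\mathcal{A})$ is the category of cosheaves and bounded natural transformations, and plain $\mathbf{CoShv}(\cdot,\cdot)$, $\mathbf{Shv}(\cdot,\cdot)$ denote Banach spaces of morphisms. Each cosheaf $\mu$ determines, uniquely up to unique isomorphism, a cocontinuous functor $\int_\Omega\mathrm{d}\mu\colon\mathbf{Shv}(\Omega)\to\mathcal{A}$ with $\int_\Omega\chi(E)\,\mathrm{d}\mu\cong\mu(E)$ naturally in $E$. The indefinite integral of $\xi$ is the cosheaf $$\int\xi\,\mathrm{d}\mu\colon E\mapsto\int_E\xi\,\mathrm{d}\mu:=\int_\Omega\chi(E)\otimes\xi\,\mathrm{d}\mu.$$ Hom-sheaf: for cosheaves $\mu,\nu$, $\mathbf{CoShv}(\mu,\nu)$ as a sheaf on $\Omega$ sends $E$ to the Banach space of bounded natural transformations $\mu|_E\to\nu|_E$ between the restrictions to $\{F\in\Omega: F\subseteq E\}$, with restriction maps given by restricting natural transformations. *)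

(* Defs.v *)
From HB Require Import structures.
From mathcomp Require Import all_boot all_order all_algebra.
From mathcomp Require Import boolp classical_sets filter reals.
From mathcomp Require Import topology normedtype.
From mathcomp Require Import complex.

Set Implicit Arguments.
Unset Strict Implicit.
Unset Printing Implicit Defensive.

Import Order.TTheory GRing.Theory Num.Theory.
Import numFieldNormedType.Exports.

Local Open Scope classical_set_scope.
Local Open Scope ring_scope.

Variant scalar_field :=
  | RealField of realType
  | ComplexField of realType.

Definition scalars (F : scalar_field) : numFieldType :=
  match F with RealField R => R | ComplexField R => R[i] end.
Coercion scalars : scalar_field >-> Num.NumField.type.

Lemma real_inf (R : realType) (S : set R) (x0 : R) :
    S x0 -> (forall x, S x -> 0 <= x) ->
  exists2 m : R, forall x, S x -> m <= x &
    forall m' : R, 0 <= m' -> (forall x, S x -> m' <= x) -> m' <= m.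
Proof.
move=> Sx0 S0; have lS : has_lbound S by exists 0 => x /S0.
exists (inf S) => [x Sx|m' _ m'P]; first exact: ge_inf.
by apply: lb_le_inf; first by exists x0.
Qed.

Local Notation Cre := (@complex.Re _).
Local Notation Cim := (@complex.Im _).

Lemma complex_inf (R : realType) (S : set R[i]) (x0 : R[i]) :
    S x0 -> (forall x, S x -> 0 <= x) ->
  exists2 m : R[i], forall x, S x -> m <= x &
    forall m' : R[i], 0 <= m' -> (forall x, S x -> m' <= x) -> m' <= m.
Proof.
move=> Sx0 S0.
have reS (x : R[i]) : 0 <= x -> x = (Cre x)%:C%C by move=> /ger0_real /RRe_real.
have lS : has_lbound (Cre @` S).
  by exists 0 => _ [x /S0 + <-]; rewrite lecE => /andP[].
exists (inf (Cre @` S))%:C%C => [x Sx|m' m'0 m'P].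
  by rewrite (reS _ (S0 _ Sx)) lecR; apply: (ge_inf lS); exists x.
rewrite (reS _ m'0) lecR; apply: lb_le_inf; first by exists (Cre x0), x0.
by move=> _ [x /m'P + <-]; rewrite lecE => /andP[].
Qed.

Lemma scalars_inf (K : scalar_field) (S : set K) (x0 : K) :
    S x0 -> (forall x, S x -> 0 <= x) ->
  exists2 m : K, forall x, S x -> m <= x &
    forall m' : K, 0 <= m' -> (forall x, S x -> m' <= x) -> m' <= m.
Proof. by case: K S x0 => R S x0; [exact: real_inf|exact: complex_inf]. Qed.

Lemma complex_complete (R : realType)
    (F : set_system (R[i]^o : pseudoMetricType R[i])) :
  ProperFilter F -> cauchy F -> cvg F.
Proof.
move=> FF /cauchyP Fc.
have leRe (z : R[i]) : `|Cre z|%:C%C <= `|z|.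
  rewrite normc_def lecR -sqrtr_sqr ler_wsqrtr//.
  by rewrite lerDl sqr_ge0.
have leIm (z : R[i]) : `|Cim z|%:C%C <= `|z|.
  rewrite normc_def lecR -sqrtr_sqr ler_wsqrtr//.
  by rewrite lerDr sqr_ge0.
have key (p : R[i] -> R) : {morph p : x y / x - y} ->
    (forall z, `|p z|%:C%C <= `|z|) ->
    exists l : R, forall e : R, 0 < e -> F [set z | `|l - p z| <= e].
  move=> pB pn.
  have FpF : ProperFilter ((p : R[i]^o -> R) @ F) by exact: fmap_proper_filter.
  have pF : cauchy ((p : R[i]^o -> R) @ F).
    apply: (@cauchy_exP R R) => e e0.
    have [|z Fz] := Fc e%:C%C; first by rewrite ltcR.
    exists (p z); apply: (@filterS _ F _ _ _ _ Fz) => y /=.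
    rewrite -!ball_normE /= => zy.
    by rewrite -ltcR -pB (le_lt_trans (pn _)).
  have [l /cvgrPdist_le lP] := (cvg_ex _).1 (@R_complete R _ FpF pF).
  by exists l => e e0; exact: (lP e e0).
have ReB : {morph (@complex.Re R) : x y / x - y} by case=> ? ? [].
have ImB : {morph (@complex.Im R) : x y / x - y} by case=> ? ? [].
have [a aP] := key _ ReB leRe.
have [b bP] := key _ ImB leIm.
apply/cvg_ex; exists ((a +i* b)%C : R[i]^o).
apply/cvgrPdist_le => e e0.
have ee : e = (Cre e)%:C%C by move/ltW/ger0_real/RRe_real: (e0).
have re0 : 0 < Cre e / 2 by rewrite divr_gt0//; move: e0; rewrite ltcE => /andP[].
apply: (@filterS _ F _ _ _ _ (filterI (aP _ re0) (bP _ re0))) => z /= [za zb].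
have -> : ((a +i* b)%C - z : R[i]) = (a - Cre z)%:C%C + 'i%C * (b - Cim z)%:C%C.
  by case: z {za zb} => x y; exact: (complexE ((a - x) +i* (b - y))%C).
rewrite (le_trans (ler_normD _ _))// normrM.
have -> : `|'i%C : R[i]| = 1.
  by rewrite normc_def /= expr0n expr1n add0r sqrtr1.
rewrite mul1r !normc_def /= !expr0n /= !addr0 !sqrtr_sqr -rmorphD ee lecR.
by rewrite [leRHS]splitr lerD.
Qed.

Lemma scalars_complete (K : scalar_field)
    (F : set_system (K^o : pseudoMetricType K)) :
  ProperFilter F -> cauchy F -> cvg F.
Proof. by case: K F => R F; [exact: R_complete|exact: complex_complete]. Qed.

Section WeightedSup.
Variable K : scalar_field.

(* Data for the Banach space [ell] of the families (x_i) in a closed subspace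
   [fs_mem] of a product of Banach spaces such that |x_i| <= M w_i for some M,
   normed by the least such M. Unit weights give the sup norm; the family
   (f x)_x with weights |x| gives the operator norm of f. *)
Record family_space := FamilySpace {
  fs_idx : Type;
  fs_fib : fs_idx -> completeNormedModType K;
  fs_wt : fs_idx -> K;
  fs_wt_ge0 : forall i, 0 <= fs_wt i;
  fs_mem : (forall i, fs_fib i) -> Prop;
  fs_mem0 : fs_mem (fun=> 0);
  fs_mem_lin : forall (k : K) x y, fs_mem x -> fs_mem y ->
    fs_mem (fun i => k *: x i + y i);
  fs_mem_closed : forall x,
    (forall e : K, 0 < e ->
       exists2 y, fs_mem y & forall i, `|x i - y i| <= e * fs_wt i) ->
    fs_mem x }.

Variable S : family_space.

Definition fs_bound (M : K) (x : forall i : fs_idx S, fs_fib i) :=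
  0 <= M /\ forall i, `|x i| <= M * fs_wt i.

Record ell := Ell {
  ell_fun :> forall i : fs_idx S, fs_fib i;
  ell_bounded : exists M, fs_bound M ell_fun;
  ell_mem : fs_mem ell_fun }.

Lemma ell_eq (x y : ell) : (forall i, x i = y i) -> x = y.
Proof.
case: x y => [x bx mx] [y b_y my] /= exy.
have {}exy : x = y by exact: functional_extensionality_dep.
by subst y; congr Ell; exact: Prop_irrelevance.
Qed.

HB.instance Definition _ := gen_eqMixin ell.
HB.instance Definition _ := gen_choiceMixin ell.

Lemma ell_lin_bounded (k : K) (x y : ell) :
  exists M, fs_bound M (fun i => k *: x i + y i).
Proof.
case: (ell_bounded x) (ell_bounded y) => [M [M0 xM]] [N [N0 yN]].
exists (`|k| * M + N); split; first by rewrite addr_ge0 ?mulr_ge0.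
move=> i; rewrite (le_trans (ler_normD _ _))// mulrDl lerD//.
by rewrite normrZ -mulrA ler_wpM2l ?normr_ge0 ?xM.
Qed.

Definition ell_lin k (x y : ell) : ell :=
  Ell (ell_lin_bounded k x y) (fs_mem_lin k (ell_mem x) (ell_mem y)).

Lemma ell0_bounded : exists M, fs_bound M (fun i => 0 : fs_fib i).
Proof. by exists 0; split=> // i; rewrite normr0 mul0r. Qed.

Definition ell0 : ell := Ell ell0_bounded (fs_mem0 S).

Definition ell_add x y := ell_lin 1 x y.
Definition ell_scale k x := ell_lin k x ell0.
Definition ell_opp x := ell_scale (-1) x.

Fact ell_addA : associative ell_add.
Proof. by move=> x y z; apply: ell_eq => i /=; rewrite !scale1r addrA. Qed.
Fact ell_addC : commutative ell_add.
Proof. by move=> x y; apply: ell_eq => i /=; rewrite !scale1r addrC. Qed.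
Fact ell_add0 : left_id ell0 ell_add.
Proof. by move=> x; apply: ell_eq => i /=; rewrite !scale1r add0r. Qed.
Fact ell_addN : left_inverse ell0 ell_opp ell_add.
Proof.
by move=> x; apply: ell_eq => i /=; rewrite scale1r scaleN1r addr0 addNr.
Qed.

HB.instance Definition _ :=
  GRing.isZmodule.Build ell ell_addA ell_addC ell_add0 ell_addN.

Fact ell_scaleA a b x : ell_scale a (ell_scale b x) = ell_scale (a * b) x.
Proof. by apply: ell_eq => i /=; rewrite !addr0 scalerA. Qed.
Fact ell_scale1 : left_id 1 ell_scale.
Proof. by move=> x; apply: ell_eq => i /=; rewrite addr0 scale1r. Qed.
Fact ell_scaleDr : right_distributive ell_scale +%R.
Proof.
by move=> a x y; apply: ell_eq => i /=; rewrite !addr0 !scale1r scalerDr.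
Qed.
Fact ell_scaleDl x : {morph ell_scale^~ x : a b / a + b}.
Proof.
by move=> a b; apply: ell_eq => i /=; rewrite !addr0 !scale1r scalerDl.
Qed.

HB.instance Definition _ := GRing.Zmodule_isLmodule.Build K ell
  ell_scaleA ell_scale1 ell_scaleDr ell_scaleDl.

Lemma ellD (x y : ell) i : (x + y) i = x i + y i.
Proof. by rewrite [LHS]/= scale1r. Qed.
Lemma ellZ k (x : ell) i : (k *: x) i = k *: x i.
Proof. by rewrite [LHS]/= addr0. Qed.
Lemma ellN (x : ell) i : (- x) i = - x i.
Proof. by rewrite [LHS]/= addr0 scaleN1r. Qed.
Lemma ellB (x y : ell) i : (x - y) i = x i - y i.
Proof. by rewrite ellD ellN. Qed.

Lemma least_bound_ex (x : ell) :
  exists m, fs_bound m x /\ forall m', fs_bound m' x -> m <= m'.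
Proof.
have [M xM] := ell_bounded x.
have [|m mP mG] := @scalars_inf K [set M | fs_bound M x] M xM; first by move=> ? [].
exists m; split => //; split=> [|i]; first by apply: mG => // ? [].
have [w0|w0] := eqVneq (fs_wt i) 0.
  by case: xM => _ /(_ i); rewrite w0 !mulr0.
have wp : 0 < fs_wt i by rewrite lt_def w0 fs_wt_ge0.
rewrite -ler_pdivrMr//; apply: mG => [|M' [M'0 /(_ i)]]; first by rewrite divr_ge0 ?normr_ge0 ?ltW.
by rewrite ler_pdivrMr.
Qed.

Definition ell_norm (x : ell) : K :=
  xget 0 [set m | fs_bound m x /\ forall m', fs_bound m' x -> m <= m'].

Lemma ell_normP (x : ell) :
  fs_bound (ell_norm x) x /\ forall m, fs_bound m x -> ell_norm x <= m.
Proof. exact: (xgetPex 0 (least_bound_ex x)). Qed.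

Lemma ell_norm_ge0 x : 0 <= ell_norm x.
Proof. by have [[]] := ell_normP x. Qed.

Lemma ell_norm_pt (x : ell) i : `|x i| <= ell_norm x * fs_wt i.
Proof. by have [[]] := ell_normP x. Qed.

Lemma ell_norm_le (x : ell) m : 0 <= m -> (forall i, `|x i| <= m * fs_wt i) ->
  ell_norm x <= m.
Proof. by move=> m0 xm; have [_] := ell_normP x; apply; split. Qed.

Fact ell_normD x y : ell_norm (x + y) <= ell_norm x + ell_norm y.
Proof.
apply: ell_norm_le => [|i]; first by rewrite addr_ge0 ?ell_norm_ge0.
by rewrite ellD mulrDl (le_trans (ler_normD _ _))// lerD ?ell_norm_pt.
Qed.

Fact ell_normZ_le k x : ell_norm (k *: x) <= `|k| * ell_norm x.
Proof.
apply: ell_norm_le => [|i]; first by rewrite mulr_ge0 ?ell_norm_ge0.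
by rewrite ellZ normrZ -mulrA ler_wpM2l ?ell_norm_pt.
Qed.

Fact ell_norm_eq0 x : ell_norm x = 0 -> x = 0.
Proof.
move=> x0; apply: ell_eq => i; apply/eqP; rewrite -normr_le0.
by rewrite (le_trans (ell_norm_pt _ _))// x0 mul0r.
Qed.

Fact ell_normZ k x : ell_norm (k *: x) = `|k| * ell_norm x.
Proof.
apply: le_anti; rewrite ell_normZ_le /=.
have [->|k0] := eqVneq k 0; first by rewrite normr0 mul0r ell_norm_ge0.
rewrite -ler_pdivlMl ?normr_gt0// -normfV.
by rewrite -{1}[x]scale1r -(mulVf k0) -scalerA ell_normZ_le.
Qed.

HB.instance Definition _ :=
  Lmodule_isNormed.Build K ell ell_normD ell_normZ ell_norm_eq0.

Fact ell_complete (F : set_system ell) : ProperFilter F -> cauchy F -> cvg F.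
Proof.
move=> FF /cauchyP Fc.
have Fe (e : K) : 0 < e -> exists x0 : ell,
    F [set x | forall i, `|x0 i - x i| <= e * fs_wt i].
  move=> e0; have [x0 Fx0] := Fc e e0; exists x0.
  apply: (@filterS _ F _ _ _ _ Fx0) => x; rewrite -ball_normE /= => x0x i.
  rewrite -ellB (le_trans (ell_norm_pt _ _))// ler_wpM2r ?fs_wt_ge0//.
  exact: ltW.
have lim_i i : exists l : fs_fib i, forall d : K, 0 < d ->
    F [set x : ell | `|l - x i| <= d].
  pose G : set_system (fs_fib i) := (fun x : ell => x i) @ F.
  have FG : ProperFilter G by exact: fmap_proper_filter.
  have cG : cauchy G.
    apply: (@cauchy_exP K) => d d0.
    have w1 : 0 < fs_wt i + 1 by rewrite ltr_wpDl ?fs_wt_ge0.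
    have [|x0 Fx0] := Fe (d / (fs_wt i + 1)); first by rewrite divr_gt0.
    exists (x0 i); apply: (@filterS _ F _ _ _ _ Fx0) => x /(_ i).
    rewrite -ball_normE /= => /le_lt_trans; apply.
    by rewrite mulrAC ltr_pdivrMr// ltr_pM2l// ltrDl.
  have [l /cvgrPdist_le lP] := (cvg_ex _).1 (@cauchy_cvg _ G FG cG).
  by exists l => d d0; exact: (lP d d0).
pose l i := sval (cid (lim_i i)).
have lP i (d : K) : 0 < d -> F [set x : ell | `|l i - x i| <= d].
  by rewrite /l; case: cid => /= ?; apply.
have near_l (e : K) x0 : 0 < e ->
    F [set x : ell | forall i, `|x0 i - x i| <= e * fs_wt i] ->
    forall i, `|l i - x0 i| <= e * fs_wt i.
  move=> e0 Fx0 i; apply/ler_addgt0Pr => d d0.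
  have [x [/= /(_ i) x0x lx]] := filter_ex (filterI Fx0 (lP i d d0)).
  have -> : l i - x0 i = (x i - x0 i) + (l i - x i) by rewrite [RHS]addrC subrKA.
  by rewrite (le_trans (ler_normD _ _))// lerD// distrC.
have lb : exists M, fs_bound M l.
  have [|x0 Fx0] := Fe 1; first exact: ltr01.
  have [M [M0 x0M]] := ell_bounded x0.
  exists (1 + M); split=> [|i]; first by rewrite addr_ge0.
  have -> : l i = (l i - x0 i) + x0 i by rewrite subrK.
  rewrite (le_trans (ler_normD _ _))// mulrDl lerD//.
  exact: near_l Fx0 i.
have lm : fs_mem l.
  apply: fs_mem_closed => e e0; have [x0 Fx0] := Fe e e0.
  by exists x0; [exact: ell_mem | exact: near_l Fx0].
apply/cvg_ex; exists (Ell lb lm); apply/cvgrPdist_le => e e0.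
have e20 : 0 < e / 2 by rewrite divr_gt0.
have [x0 Fx0] := Fe _ e20.
apply: (@filterS _ F _ _ _ _ Fx0) => x /= x0x.
apply: ell_norm_le => [|i]; first exact: ltW.
rewrite ellB /= -(subrKA (x0 i)) (le_trans (ler_normD _ _))//.
by rewrite [e]splitr mulrDl lerD//; exact: near_l Fx0 i.
Qed.

HB.instance Definition _ := Uniform_isComplete.Build ell ell_complete.

End WeightedSup.

Section BanachSpaces.
Variable K : scalar_field.
Implicit Types X Y Z : completeNormedModType K.

Lemma small_eq0 X (v : X) (c : K) : 0 <= c ->
  (forall e : K, 0 < e -> `|v| <= e * c) -> v = 0.
Proof.
move=> c0 vP; apply/eqP; rewrite -normr_le0; apply/ler_addgt0Pr => e e0.
have c1 : 0 < c + 1 by rewrite ltr_wpDl.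
rewrite add0r (le_trans (vP (e / (c + 1)) _)) ?divr_gt0//.
by rewrite mulrAC ler_pdivrMr// ler_pM2l// lerDl.
Qed.

Program Definition blin_space X Y : family_space K :=
  @FamilySpace K X (fun=> Y) (fun x => `|x|) _
    (fun f => linear (f : X -> Y)) _ _ _.
Next Obligation. by move=> X Y x; exact: normr_ge0. Qed.
Next Obligation. by move=> X Y k x y; rewrite scaler0 addr0. Qed.
Next Obligation.
move=> X Y k f g /= fl gl l x y; rewrite fl gl !scalerDr !scalerA.
by rewrite (mulrC l) addrACA.
Qed.
Next Obligation.
move=> X Y f fP k x y; apply/eqP; rewrite -subr_eq0; apply/eqP.
apply: (@small_eq0 _ _ (`|k *: x + y| + (`|k| * `|x| + `|y|))) => [|e e0].
  by rewrite !addr_ge0 ?mulr_ge0.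
have [g gl fg] := fP e e0.
have -> : f (k *: x + y) - (k *: f x + f y) =
    (f (k *: x + y) - g (k *: x + y)) - (k *: (f x - g x) + (f y - g y)).
  by rewrite gl scalerBr (addrACA (k *: f x)) -opprD opprB subrKA.
rewrite (le_trans (ler_normB _ _))// mulrDr lerD ?fg//.
rewrite (le_trans (ler_normD _ _))// mulrDr lerD ?fg//.
by rewrite normrZ mulrCA ler_wpM2l ?normr_ge0 ?fg.
Qed.

Definition blin X Y : completeNormedModType K := ell (blin_space X Y).

Definition bapp X Y (f : blin X Y) : X -> Y := @ell_fun K (blin_space X Y) f.

Lemma bapp_linear X Y (f : blin X Y) : linear (bapp f).
Proof. exact: (@ell_mem K (blin_space X Y) f). Qed.

Lemma bapp_norm X Y (f : blin X Y) x : `|bapp f x| <= `|f| * `|x|.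
Proof. exact: (@ell_norm_pt K (blin_space X Y) f x). Qed.

Lemma blin_norm_le X Y (f : blin X Y) (M : K) : 0 <= M ->
  (forall x, `|bapp f x| <= M * `|x|) -> `|f| <= M.
Proof. exact: (@ell_norm_le K (blin_space X Y) f). Qed.

Lemma blin_eq X Y (f g : blin X Y) : (forall x, bapp f x = bapp g x) -> f = g.
Proof. exact: (@ell_eq K (blin_space X Y)). Qed.

Lemma blin_lin X Y k (f g : blin X Y) x :
  bapp (k *: f + g) x = k *: bapp f x + bapp g x.
Proof. by rewrite /bapp ellD ellZ. Qed.

Definition mk_blin X Y (f : X -> Y) (fl : linear f) (M : K)
    (M0 : 0 <= M) (fM : forall x, `|f x| <= M * `|x|) : blin X Y :=
  @Ell K (blin_space X Y) f (ex_intro _ M (conj M0 fM)) fl.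

Lemma bapp0 X Y (f : blin X Y) : bapp f 0 = 0.
Proof.
have := bapp_linear f 1 0 0; rewrite scaler0 addr0 scale1r => /eqP.
by rewrite -subr_eq0 opprD addNKr oppr_eq0 => /eqP.
Qed.

Definition prod_space (J : Type) (B : J -> completeNormedModType K) :=
  @FamilySpace K J B (fun=> 1) (fun=> ler01) (fun=> True) I
    (fun _ _ _ _ _ => I) (fun _ _ => I).

Definition ban_prod J (B : J -> completeNormedModType K) :
  completeNormedModType K := ell (prod_space B).

Definition bcoord J (B : J -> completeNormedModType K) (x : ban_prod B) :
  forall i, B i := @ell_fun K (prod_space B) x.

Definition scalar_ban : completeNormedModType K :=
  HB.pack (K^o) (Uniform_isComplete.Build K^o (@scalars_complete K)).

Definition zero_ban : completeNormedModType K :=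
  ban_prod (fun _ : void => scalar_ban).

End BanachSpaces.

Section BanachCategories.
Variable K : scalar_field.

Record ban_cat_on (T : Type) := BanCatOn {
  bc_hom : T -> T -> completeNormedModType K;
  bc_id : forall a, bc_hom a a;
  bc_comp : forall a b c, bc_hom b c -> bc_hom a b -> bc_hom a c;
  bc_linl : forall a b c (f : bc_hom a b),
    linear (fun g : bc_hom b c => bc_comp g f);
  bc_linr : forall a b c (g : bc_hom b c),
    linear (fun f : bc_hom a b => bc_comp g f);
  bc_norm_comp : forall a b c (g : bc_hom b c) (f : bc_hom a b),
    `|bc_comp g f| <= `|g| * `|f|;
  bc_norm_id : forall a, `|bc_id a| <= 1;
  bc_compA : forall a b c d (h : bc_hom c d) (g : bc_hom b c) (f : bc_hom a b),
    bc_comp h (bc_comp g f) = bc_comp (bc_comp h g) f;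
  bc_comp1f : forall a b (f : bc_hom a b), bc_comp (bc_id b) f = f;
  bc_compf1 : forall a b (f : bc_hom a b), bc_comp f (bc_id a) = f }.

Record ban_cat := BanCat { bc_obj :> Type; bc_str : ban_cat_on bc_obj }.

(* "Small" is relative to the universe of the carriers of Banach spaces. *)
Record small_ban_cat := SmallBanCat {
  sbc_obj : Type@{CompleteNormedModule.axioms_.u0};
  sbc_str : ban_cat_on sbc_obj }.
Coercion small_ban_cat_ban_cat (D : small_ban_cat) : ban_cat :=
  BanCat (sbc_str D).

Definition mor (C : ban_cat) (a b : C) : completeNormedModType K :=
  bc_hom (bc_str C) a b.
Definition idm (C : ban_cat) (a : C) : mor a a := bc_id (bc_str C) a.
Definition mcomp (C : ban_cat) (a b c : C) (g : mor b c) (f : mor a b) :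
  mor a c := bc_comp g f.
Local Notation "g ∘ f" := (mcomp g f) (at level 40, left associativity).

Section Theory.
Variable C : ban_cat.
Implicit Types a b c d : C.

Lemma compA a b c d (h : mor c d) (g : mor b c) (f : mor a b) :
  h ∘ (g ∘ f) = h ∘ g ∘ f.
Proof. exact: bc_compA. Qed.
Lemma comp1f a b (f : mor a b) : idm b ∘ f = f.
Proof. exact: bc_comp1f. Qed.
Lemma compf1 a b (f : mor a b) : f ∘ idm a = f.
Proof. exact: bc_compf1. Qed.
Lemma comp_linl a b c k (g g' : mor b c) (f : mor a b) :
  (k *: g + g') ∘ f = k *: (g ∘ f) + g' ∘ f.
Proof. exact: bc_linl. Qed.
Lemma comp_linr a b c k (g : mor b c) (f f' : mor a b) :
  g ∘ (k *: f + f') = k *: (g ∘ f) + g ∘ f'.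
Proof. exact: bc_linr. Qed.
Lemma comp_subl a b c (g g' : mor b c) (f : mor a b) :
  (g - g') ∘ f = g ∘ f - g' ∘ f.
Proof. by rewrite addrC -scaleN1r comp_linl scaleN1r addrC. Qed.
Lemma comp_subr a b c (g : mor b c) (f f' : mor a b) :
  g ∘ (f - f') = g ∘ f - g ∘ f'.
Proof. by rewrite addrC -scaleN1r comp_linr scaleN1r addrC. Qed.
Lemma comp0l a b c (f : mor a b) : (0 : mor b c) ∘ f = 0.
Proof. by rewrite -(subrr (0 : mor b c)) comp_subl subrr. Qed.
Lemma comp0r a b c (g : mor b c) : g ∘ (0 : mor a b) = 0.
Proof. by rewrite -(subrr (0 : mor a b)) comp_subr subrr. Qed.
Lemma norm_comp a b c (g : mor b c) (f : mor a b) : `|g ∘ f| <= `|g| * `|f|.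
Proof. exact: bc_norm_comp. Qed.
Lemma norm_idm a : `|idm a| <= 1.
Proof. exact: bc_norm_id. Qed.

Lemma norm_comp_le1 a b c (g : mor b c) (f : mor a b) :
  `|g| <= 1 -> `|f| <= 1 -> `|g ∘ f| <= 1.
Proof. by move=> g1 f1; rewrite (le_trans (norm_comp _ _))// mulr_ile1. Qed.

End Theory.

Definition isometric_iso (C : ban_cat) (a b : C) (f : mor a b) :=
  exists g : mor b a,
    [/\ g ∘ f = idm a, f ∘ g = idm b, `|f| <= 1 & `|g| <= 1].

Program Definition op_on T (C : ban_cat_on T) : ban_cat_on T :=
  @BanCatOn T (fun a b => bc_hom C b a) (bc_id C)
    (fun a b c g f => bc_comp f g) _ _ _ _ _ _ _.
Next Obligation. by move=> *; exact: bc_linr. Qed.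
Next Obligation. by move=> *; exact: bc_linl. Qed.
Next Obligation. by move=> *; rewrite mulrC; exact: bc_norm_comp. Qed.
Next Obligation. by move=> *; exact: bc_norm_id. Qed.
Next Obligation. by move=> *; symmetry; exact: bc_compA. Qed.
Next Obligation. by move=> *; exact: bc_compf1. Qed.
Next Obligation. by move=> *; exact: bc_comp1f. Qed.

Definition opcat (C : ban_cat) : ban_cat := BanCat (op_on (bc_str C)).

Program Definition full_on (C : ban_cat) (P : C -> Prop) : ban_cat_on {a | P a} :=
  @BanCatOn {a : C | P a} (fun a b => mor (sval a) (sval b))
    (fun a => idm (sval a)) (fun a b c g f => g ∘ f) _ _ _ _ _ _ _.
Next Obligation. by move=> *; exact: bc_linl. Qed.
Next Obligation. by move=> *; exact: bc_linr. Qed.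
Next Obligation. by move=> *; exact: norm_comp. Qed.
Next Obligation. by move=> *; exact: norm_idm. Qed.
Next Obligation. by move=> *; exact: compA. Qed.
Next Obligation. by move=> *; exact: comp1f. Qed.
Next Obligation. by move=> *; exact: compf1. Qed.

Definition fullcat (C : ban_cat) (P : C -> Prop) : ban_cat := BanCat (full_on P).

Section Ban.
Implicit Types X Y Z W : completeNormedModType K.

Lemma blin_id_linear X : linear (@id X). Proof. by []. Qed.
Lemma blin_id_bound X (x : X) : `|id x| <= 1 * `|x|. Proof. by rewrite mul1r. Qed.
Definition blin_id X : blin X X :=
  mk_blin (@blin_id_linear X) ler01 (@blin_id_bound X).

Lemma blin_comp_linear X Y Z (g : blin Y Z) (f : blin X Y) :
  linear (bapp g \o bapp f).
Proof. by move=> k x y /=; rewrite !bapp_linear. Qed.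
Lemma blin_comp_bound X Y Z (g : blin Y Z) (f : blin X Y) x :
  `|(bapp g \o bapp f) x| <= (`|g| * `|f|) * `|x|.
Proof.
by rewrite (le_trans (bapp_norm _ _))// -mulrA ler_wpM2l ?bapp_norm ?normr_ge0.
Qed.
Definition blin_comp X Y Z (g : blin Y Z) (f : blin X Y) : blin X Z :=
  mk_blin (blin_comp_linear g f) (mulr_ge0 (normr_ge0 g) (normr_ge0 f))
    (blin_comp_bound g f).

Lemma blin_compE X Y Z (g : blin Y Z) (f : blin X Y) x :
  bapp (blin_comp g f) x = bapp g (bapp f x).
Proof. by []. Qed.

Program Definition Ban_on : ban_cat_on (completeNormedModType K) :=
  @BanCatOn _ (@blin K) blin_id blin_comp _ _ _ _ _ _ _.
Next Obligation.
by move=> X Y Z f k g h; apply: blin_eq => x; rewrite blin_lin !blin_compE blin_lin.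
Qed.
Next Obligation.
move=> X Y Z g k f h; apply: blin_eq => x.
by rewrite blin_lin !blin_compE blin_lin bapp_linear.
Qed.
Next Obligation.
move=> X Y Z g f; apply: blin_norm_le; first by rewrite mulr_ge0.
exact: blin_comp_bound.
Qed.
Next Obligation.
by move=> X; apply: blin_norm_le => //; exact: blin_id_bound.
Qed.
Next Obligation. by move=> *; apply: blin_eq. Qed.
Next Obligation. by move=> *; apply: blin_eq. Qed.
Next Obligation. by move=> *; apply: blin_eq. Qed.

Definition Ban : ban_cat := BanCat Ban_on.

End Ban.

Definition bapply (X Y : Ban) (f : mor X Y) (x : X) : Y := bapp f x.

Lemma app_linear (X Y : Ban) (f : mor X Y) k x y :
  bapply f (k *: x + y) = k *: bapply f x + bapply f y.
Proof. exact: bapp_linear. Qed.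
Lemma app_norm (X Y : Ban) (f : mor X Y) x : `|bapply f x| <= `|f| * `|x|.
Proof. exact: bapp_norm. Qed.
Lemma app_norm1 (X Y : Ban) (f : mor X Y) x : `|f| <= 1 -> `|bapply f x| <= `|x|.
Proof.
by move=> f1; rewrite (le_trans (app_norm _ _))// ler_piMl.
Qed.
Lemma app_comp (X Y Z : Ban) (g : mor Y Z) (f : mor X Y) x :
  bapply (g ∘ f) x = bapply g (bapply f x).
Proof. by []. Qed.
Lemma app_idm (X : Ban) x : bapply (idm X) x = x.
Proof. by []. Qed.
Lemma app_eq (X Y : Ban) (f g : mor X Y) : (forall x, bapply f x = bapply g x) -> f = g.
Proof. exact: blin_eq. Qed.

Record bfunctor (A B : ban_cat) := BFunctor {
  bf_obj :> A -> B;
  bf_hom : forall a b : A, @mor Ban (mor a b) (mor (bf_obj a) (bf_obj b));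
  bf_contr : forall a b, `|bf_hom a b| <= 1;
  bf_idm : forall a, bapply (bf_hom a a) (idm a) = idm (bf_obj a);
  bf_comp : forall (a b c : A) (g : mor b c) (f : mor a b),
    bapply (bf_hom a c) (g ∘ f) = bapply (bf_hom b c) g ∘ bapply (bf_hom a b) f }.

Definition bf_map (A B : ban_cat) (F : bfunctor A B) (a b : A) (f : mor a b) :
  mor (F a) (F b) := bapply (bf_hom F a b) f.

Lemma bf_map_norm A B (F : bfunctor A B) (a b : A) (f : mor a b) :
  `|bf_map F f| <= `|f|.
Proof. exact/app_norm1/bf_contr. Qed.

Lemma bf_mapM A B (F : bfunctor A B) (a b c : A) (g : mor b c) (f : mor a b) :
  bf_map F (g ∘ f) = bf_map F g ∘ bf_map F f.
Proof. exact: bf_comp. Qed.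

Program Definition bf_compose (A B C : ban_cat) (G : bfunctor B C)
    (F : bfunctor A B) : bfunctor A C :=
  @BFunctor A C (fun a => G (F a))
    (fun a b => bf_hom G (F a) (F b) ∘ bf_hom F a b) _ _ _.
Next Obligation. by move=> *; exact/norm_comp_le1/bf_contr/bf_contr. Qed.
Next Obligation. by move=> *; rewrite app_comp !bf_idm. Qed.
Next Obligation. by move=> *; rewrite !app_comp !bf_comp. Qed.

Record bnat (A B : ban_cat) (F G : bfunctor A B) := BNat {
  bn_app :> forall a, mor (F a) (G a);
  bn_natural : forall (a b : A) (f : mor a b),
    bf_map G f ∘ bn_app a = bn_app b ∘ bf_map F f;
  bn_bounded : exists M : K, forall a, `|bn_app a| <= M }.

(* Weighted colimits: [lam] exhibits [L] as the colimit of [F] weighted by [W],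
   i.e. composition with [lam] is an isometric isomorphism from [mor L a] onto
   the Banach space of bounded natural transformations from [W] to [mor (F -) a]. *)
Section WeightedColimits.
Variables (D : small_ban_cat) (W : bfunctor (opcat D) Ban) (A : ban_cat).

Definition is_wcocone (F : bfunctor D A) (a : A)
    (c : forall x : D, @mor Ban (W x) (mor (F x) a)) :=
  forall (x y : D) (f : mor x y) (w : W y),
    bapply (c x) (bapply (@bf_map (opcat D) Ban W y x f) w) = bapply (c y) w ∘ bf_map F f.

Definition is_wcolim (F : bfunctor D A) (L : A)
    (lam : forall x : D, @mor Ban (W x) (mor (F x) L)) :=
  [/\ is_wcocone lam, forall x, `|lam x| <= 1 &
    forall (a : A) (c : forall x : D, @mor Ban (W x) (mor (F x) a)) (M : K),
      0 <= M -> is_wcocone c -> (forall x, `|c x| <= M) ->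
      exists2 f : mor L a,
        `|f| <= M /\ (forall x w, f ∘ bapply (lam x) w = bapply (c x) w) &
        forall g : mor L a, (forall x w, g ∘ bapply (lam x) w = bapply (c x) w) ->
          g = f].

End WeightedColimits.

Definition cocomplete (A : ban_cat) :=
  forall (D : small_ban_cat) (W : bfunctor (opcat D) Ban) (F : bfunctor D A),
    exists (L : A) (lam : forall x : D, @mor Ban (W x) (mor (F x) L)),
      is_wcolim lam.

Definition cocontinuous (A B : ban_cat) (G : bfunctor A B) :=
  forall (D : small_ban_cat) (W : bfunctor (opcat D) Ban) (F : bfunctor D A)
    (L : A) (lam : forall x : D, @mor Ban (W x) (mor (F x) L)),
    is_wcolim lam ->
    @is_wcolim D W B (bf_compose G F) (G L)
      (fun x => bf_hom G (F x) L ∘ lam x).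

Record banach_2space := Banach2Space {
  b2_cat :> ban_cat;
  b2_cocomplete : cocomplete b2_cat }.

(* Functors on the preorder (T, le), with an arrow from x to y iff [le x y].
   Arrows are proofs of a boolean, so [po_id] and [po_comp] also say that
   [po_map] does not depend on the proof. *)
Record pofunctor (T : Type) (le : rel T) (A : ban_cat) := POFunctor {
  po_obj :> T -> A;
  po_map : forall x y, le x y -> mor (po_obj x) (po_obj y);
  po_contr : forall x y (h : le x y), `|po_map h| <= 1;
  po_id : forall x (h : le x x), po_map h = idm (po_obj x);
  po_comp : forall x y z (h : le x y) (h' : le y z) (h'' : le x z),
    po_map h'' = po_map h' ∘ po_map h }.

Section Nat.
Variables (T : Type) (le : rel T) (A : ban_cat).
Implicit Types F G H : pofunctor le A.

Definition is_natural F G (eta : forall x, mor (F x) (G x)) :=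
  forall x y (h : le x y), po_map G h ∘ eta x = eta y ∘ po_map F h.

Lemma natural0 F G : is_natural (fun x => 0 : mor (F x) (G x)).
Proof. by move=> x y h; rewrite comp0l comp0r. Qed.

Lemma natural_lin F G k (eta eta' : forall x, mor (F x) (G x)) :
  is_natural eta -> is_natural eta' -> is_natural (fun x => k *: eta x + eta' x).
Proof. by move=> n n' x y h; rewrite comp_linl comp_linr n n'. Qed.

Lemma natural_closed F G (eta : forall x, mor (F x) (G x)) :
  (forall e : K, 0 < e -> exists2 eta', is_natural eta' &
    forall x, `|eta x - eta' x| <= e * 1) -> is_natural eta.
Proof.
move=> etaP x y h; apply/eqP; rewrite -subr_eq0; apply/eqP.
apply: (@small_eq0 _ _ _ 2) => // e e0; have [eta' n le_e] := etaP e e0.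
have -> : po_map G h ∘ eta x - eta y ∘ po_map F h =
    po_map G h ∘ (eta x - eta' x) - (eta y - eta' y) ∘ po_map F h.
  by rewrite comp_subl comp_subr n opprB addrA subrK.
have le_e' z : `|eta z - eta' z| <= e by have := le_e z; rewrite mulr1.
rewrite (le_trans (ler_normB _ _))// mulr_natr mulr2n.
apply: lerD; apply: (le_trans (norm_comp _ _)).
  by apply: (le_trans _ (le_e' x)); rewrite ler_piMl ?po_contr.
by apply: (le_trans _ (le_e' y)); rewrite ler_piMr ?po_contr.
Qed.

Definition nat_space F G : family_space K :=
  @FamilySpace K T (fun x => mor (F x) (G x)) (fun=> 1) (fun=> ler01)
    (@is_natural F G) (@natural0 F G) (@natural_lin F G) (@natural_closed F G).

Definition nat_hom F G : completeNormedModType K := ell (nat_space F G).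

Definition nat_at F G (eta : nat_hom F G) : forall x, mor (F x) (G x) :=
  @ell_fun K (nat_space F G) eta.

Lemma nat_natural F G (eta : nat_hom F G) : is_natural (nat_at eta).
Proof. exact: (@ell_mem K (nat_space F G) eta). Qed.

Lemma nat_norm F G (eta : nat_hom F G) x : `|nat_at eta x| <= `|eta|.
Proof. by have := @ell_norm_pt K (nat_space F G) eta x; rewrite mulr1. Qed.

Lemma nat_norm_le F G (eta : nat_hom F G) (M : K) :
  0 <= M -> (forall x, `|nat_at eta x| <= M) -> `|eta| <= M.
Proof.
move=> M0 etaM; apply: (@ell_norm_le K (nat_space F G) eta) => // x.
by rewrite mulr1; exact: etaM.
Qed.

Lemma nat_eq F G (eta eta' : nat_hom F G) :
  (forall x, nat_at eta x = nat_at eta' x) -> eta = eta'.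
Proof. exact: (@ell_eq K (nat_space F G)). Qed.

Lemma nat_lin F G k (eta eta' : nat_hom F G) x :
  nat_at (k *: eta + eta') x = k *: nat_at eta x + nat_at eta' x.
Proof. by rewrite /nat_at ellD ellZ. Qed.

Lemma mk_nat_bounded F G (eta : forall x, mor (F x) (G x)) (M : K) :
  0 <= M -> (forall x, `|eta x| <= M) ->
  exists M, @fs_bound K (nat_space F G) M eta.
Proof. by move=> M0 etaM; exists M; split=> // x; rewrite mulr1; exact: etaM. Qed.

Definition mk_nat F G (eta : forall x, mor (F x) (G x)) (n : is_natural eta)
    (M : K) (M0 : 0 <= M) (etaM : forall x, `|eta x| <= M) : nat_hom F G :=
  @Ell K (nat_space F G) eta (mk_nat_bounded M0 etaM) n.

Lemma nat_id_bound F x : `|idm (F x)| <= 1. Proof. exact: norm_idm. Qed.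
Lemma nat_id_natural F : is_natural (fun x => idm (F x)).
Proof. by move=> x y h; rewrite comp1f compf1. Qed.
Definition nat_id F : nat_hom F F :=
  mk_nat (@nat_id_natural F) ler01 (@nat_id_bound F).

Lemma nat_comp_natural F G H (th : nat_hom G H) (eta : nat_hom F G) :
  is_natural (fun x => nat_at th x ∘ nat_at eta x).
Proof.
by move=> x y h; rewrite compA nat_natural -!compA nat_natural.
Qed.
Lemma nat_comp_bound F G H (th : nat_hom G H) (eta : nat_hom F G) x :
  `|nat_at th x ∘ nat_at eta x| <= `|th| * `|eta|.
Proof. by rewrite (le_trans (norm_comp _ _))// ler_pM ?nat_norm. Qed.
Definition nat_comp F G H (th : nat_hom G H) (eta : nat_hom F G) : nat_hom F H :=
  mk_nat (nat_comp_natural th eta) (mulr_ge0 (normr_ge0 th) (normr_ge0 eta))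
    (nat_comp_bound th eta).

Lemma nat_compE F G H (th : nat_hom G H) (eta : nat_hom F G) x :
  nat_at (nat_comp th eta) x = nat_at th x ∘ nat_at eta x.
Proof. by []. Qed.

Program Definition pofun_on : ban_cat_on (pofunctor le A) :=
  @BanCatOn _ nat_hom nat_id nat_comp _ _ _ _ _ _ _.
Next Obligation.
move=> F G H f k g h; apply: nat_eq => x.
by rewrite nat_lin !nat_compE nat_lin comp_linl.
Qed.
Next Obligation.
move=> F G H f k g h; apply: nat_eq => x.
by rewrite nat_lin !nat_compE nat_lin comp_linr.
Qed.
Next Obligation.
move=> F G H g f; apply: nat_norm_le; first by rewrite mulr_ge0.
exact: nat_comp_bound.
Qed.
Next Obligation.
by move=> F; apply: nat_norm_le => //; exact: nat_id_bound.
Qed.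
Next Obligation. by move=> *; apply: nat_eq => x; exact: compA. Qed.
Next Obligation. by move=> *; apply: nat_eq => x; exact: comp1f. Qed.
Next Obligation. by move=> *; apply: nat_eq => x; exact: compf1. Qed.

Definition pofun_cat : ban_cat := BanCat pofun_on.

End Nat.

Program Definition pf_compose (T : Type) (le : rel T) (A B : ban_cat)
    (G : bfunctor A B) (F : pofunctor le A) : pofunctor le B :=
  @POFunctor T le B (fun x => G (F x)) (fun x y h => bf_map G (po_map F h)) _ _ _.
Next Obligation.
by move=> *; exact: (le_trans (bf_map_norm _ _) (po_contr _ _)).
Qed.
Next Obligation.
by move=> T le A B G F x h; rewrite /= (po_id F h) /bf_map bf_idm.
Qed.
Next Obligation.
by move=> T le A B G F x y z h h' h''; rewrite /= (po_comp F h h' h'') /bf_map bf_comp.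
Qed.

End BanachCategories.

Notation "g ∘ f" := (mcomp g f) (at level 40, left associativity).

Section ProjectiveTensor.
Variable K : scalar_field.
Local Notation Ban := (Ban K).

Definition bilinear_map (X Y Z : Ban) (b : X -> Y -> Z) :=
  (forall y, linear (b^~ y)) /\ (forall x, linear (b x)).

(* Completed projective tensor products of all pairs of Banach spaces, given by
   their universal property for bounded bilinear maps. *)
Record projective_tensor := ProjectiveTensor {
  pt_obj :> Ban -> Ban -> Ban;
  ptens : forall X Y : Ban, X -> Y -> pt_obj X Y;
  pure_bilinear : forall X Y, bilinear_map (@ptens X Y);
  pure_norm : forall (X Y : Ban) (x : X) (y : Y), `|ptens x y| <= `|x| * `|y|;
  pt_univ : forall (X Y Z : Ban) (b : X -> Y -> Z) (M : K),
    0 <= M -> bilinear_map b -> (forall x y, `|b x y| <= M * (`|x| * `|y|)) ->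
    exists2 f : mor (pt_obj X Y) Z,
      `|f| <= M & forall x y, bapply f (ptens x y) = b x y;
  pt_ext : forall (X Y Z : Ban) (f g : mor (pt_obj X Y) Z),
    (forall x y, bapply f (ptens x y) = bapply g (ptens x y)) -> f = g }.

Variable T : projective_tensor.

Lemma pt_map_bilinear (X X' Y Y' : Ban) (f : mor X X') (g : mor Y Y') :
  bilinear_map (fun x y => ptens T (bapply f x) (bapply g y)).
Proof.
split=> [y|x] k u v; rewrite app_linear.
  by rewrite ((pure_bilinear T _ _).1).
by rewrite ((pure_bilinear T _ _).2).
Qed.

Lemma pt_map_bound (X X' Y Y' : Ban) (f : mor X X') (g : mor Y Y') x y :
  `|ptens T (bapply f x) (bapply g y)| <= (`|f| * `|g|) * (`|x| * `|y|).
Proof.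
by rewrite (le_trans (pure_norm _ _ _))// mulrACA ler_pM ?app_norm.
Qed.

Definition pt_map (X X' Y Y' : Ban) (f : mor X X') (g : mor Y Y') :
    mor (T X Y) (T X' Y') :=
  s2val (cid2 (pt_univ T (mulr_ge0 (normr_ge0 f) (normr_ge0 g))
    (pt_map_bilinear f g) (pt_map_bound f g))).

Lemma pt_mapE (X X' Y Y' : Ban) (f : mor X X') (g : mor Y Y') x y :
  bapply (pt_map f g) (ptens T x y) = ptens T (bapply f x) (bapply g y).
Proof. by rewrite /pt_map; case: cid2 => h _ /= ->. Qed.

Lemma pt_map_norm (X X' Y Y' : Ban) (f : mor X X') (g : mor Y Y') :
  `|pt_map f g| <= `|f| * `|g|.
Proof. by rewrite /pt_map; case: cid2. Qed.

Lemma pt_map_norm1 (X X' Y Y' : Ban) (f : mor X X') (g : mor Y Y') :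
  `|f| <= 1 -> `|g| <= 1 -> `|pt_map f g| <= 1.
Proof. by move=> f1 g1; rewrite (le_trans (pt_map_norm _ _))// mulr_ile1. Qed.

Lemma pt_map_id (X Y : Ban) : pt_map (idm X) (idm Y) = idm (T X Y).
Proof. by apply: (@pt_ext T) => x y; rewrite pt_mapE. Qed.

Lemma pt_map_comp (X X' X'' Y Y' Y'' : Ban) (f' : mor X' X'') (f : mor X X')
    (g' : mor Y' Y'') (g : mor Y Y') :
  pt_map (f' ∘ f) (g' ∘ g) = pt_map f' g' ∘ pt_map f g.
Proof. by apply: (@pt_ext T) => x y; rewrite app_comp !pt_mapE !app_comp. Qed.

End ProjectiveTensor.

(* An enriched left adjoint of the inclusion of the full subcategory of C on P;
   [mor (a : fullcat P) b] is convertible to [mor (sval a) (sval b)] in C. *)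
Record reflection (K : scalar_field) (C : ban_cat K) (P : C -> Prop) :=
  Reflection {
    rf_fun :> bfunctor C (fullcat P);
    rf_unit : forall a : C, mor a (sval (rf_fun a));
    rf_natural : forall (a b : C) (f : mor a b),
      rf_unit b ∘ f = (bf_map rf_fun f : @mor K C _ _) ∘ rf_unit a;
    rf_adjoint : forall (a : C) (b : fullcat P),
      exists2 c : @mor K (Ban K) (mor (rf_fun a) b) (mor a (sval b)),
        forall f, bapply c f = (f : @mor K C _ _) ∘ rf_unit a & isometric_iso c }.

Section Sheaves.
Variables (K : scalar_field) (d : Order.disp_t) (Ω : ctbDistrLatticeType d).
Local Notation Ban := (Ban K).

(* The index set may be empty: the empty family partitions [\bot]. *)
Definition is_partition (E : Ω) (n : nat) (P : 'I_n -> Ω) :=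
  [/\ forall i, P i != \bot%O,
      forall i j, i != j -> (P i `&` P j)%O = \bot%O &
      (\join_(i < n) P i)%O = E].

Lemma partition_le E n (P : 'I_n -> Ω) : is_partition E P -> forall i, (P i <= E)%O.
Proof. by case=> _ _ <- i; exact: joins_sup. Qed.

Definition geΩ : rel Ω := fun E F => (F <= E)%O.
Definition leΩ : rel Ω := fun E F => (E <= F)%O.

Definition PShv : ban_cat K := pofun_cat geΩ Ban.

Definition is_sheaf (xi : PShv) :=
  forall (E : Ω) (n : nat) (P : 'I_n -> Ω) (hP : is_partition E P),
    exists2 c : @mor K Ban (xi E) (ban_prod (fun i => xi (P i))),
      forall x i, bcoord (bapply c x) i =
                  bapply (po_map xi (partition_le hP i : geΩ E (P i))) x &
      isometric_iso c.

Definition Shv : ban_cat K := fullcat is_sheaf.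

Definition indic (b : bool) : Ban := if b then scalar_ban K else zero_ban K.

Definition indic_map (a b : bool) : mor (indic a) (indic b) :=
  match a, b return mor (indic a) (indic b) with
  | true, true => idm (scalar_ban K : Ban)
  | _, _ => 0
  end.

Lemma indic_map_norm a b : `|indic_map a b| <= 1.
Proof. by case: a b => [] [] /=; rewrite ?normr0 ?norm_idm. Qed.

Lemma zero_ban_hom (f : mor (zero_ban K : Ban) (zero_ban K : Ban)) : f = 0.
Proof. by apply: app_eq => x; apply: ell_eq; case. Qed.

Lemma indic_map_id b : indic_map b b = idm (indic b).
Proof. by case: b => //=; rewrite (zero_ban_hom (idm _)). Qed.

Lemma indic_map_comp (a b c : bool) : (a -> b) -> (b -> c) ->
  indic_map a c = indic_map b c ∘ indic_map a b.
Proof.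
case: a => [/(_ isT) -> /(_ isT) ->|_ _]; first by rewrite /= comp1f.
by case: b c => [] [] /=; rewrite comp0r.
Qed.

Program Definition yon (E : Ω) : PShv :=
  @POFunctor K Ω geΩ Ban (fun F => indic (F <= E)%O)
    (fun F G h => indic_map (F <= E)%O (G <= E)%O) _ _ _.
Next Obligation. by move=> *; exact: indic_map_norm. Qed.
Next Obligation. by move=> *; exact: indic_map_id. Qed.
Next Obligation.
by move=> E F G H h h' h''; apply: indic_map_comp; exact: le_trans.
Qed.

Lemma yon_map_natural E E' (h : leΩ E E') :
  @is_natural K Ω geΩ Ban (yon E) (yon E')
    (fun F => indic_map (F <= E)%O (F <= E')%O).
Proof.
move=> F G FG; have EE' H : (H <= E)%O -> (H <= E')%O by move=> /le_trans; apply.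
have FGH H : (F <= H)%O -> (G <= H)%O by exact: le_trans.
by rewrite /= -!indic_map_comp//; [exact: FGH|exact: EE'|exact: EE'|exact: FGH].
Qed.

Definition yon_map E E' (h : leΩ E E') : mor (yon E) (yon E') :=
  mk_nat (yon_map_natural h) ler01 (fun F => indic_map_norm _ _).

Program Definition yoneda : pofunctor leΩ PShv :=
  @POFunctor K Ω leΩ PShv yon yon_map _ _ _.
Next Obligation.
move=> E F h; apply: nat_norm_le => // G; exact: indic_map_norm.
Qed.
Next Obligation. by move=> E h; apply: nat_eq => F; exact: indic_map_id. Qed.
Next Obligation.
move=> E F G h h' h''; apply: nat_eq => H.
by apply: indic_map_comp => /le_trans; apply.
Qed.

Section Tensor.
Variables (T : projective_tensor K) (r : reflection is_sheaf).

Program Definition ptensor (xi ze : PShv) : PShv :=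
  @POFunctor K Ω geΩ Ban (fun E => T (xi E) (ze E))
    (fun E F h => pt_map T (po_map xi h) (po_map ze h)) _ _ _.
Next Obligation. by move=> *; apply: pt_map_norm1; exact: po_contr. Qed.
Next Obligation. by move=> xi ze E h; rewrite /= !po_id pt_map_id. Qed.
Next Obligation.
by move=> xi ze E F G h h' h''; rewrite -pt_map_comp -!po_comp.
Qed.

Section TensorMap.
Variables (xi xi' ze ze' : PShv) (al : mor xi xi') (be : mor ze ze').

Lemma ptensor_map_natural : @is_natural K Ω geΩ Ban (ptensor xi ze) (ptensor xi' ze')
  (fun E => pt_map T (nat_at al E) (nat_at be E)).
Proof. by move=> E F h; rewrite /= -!pt_map_comp !nat_natural. Qed.

Lemma ptensor_map_bound E :
  `|pt_map T (nat_at al E) (nat_at be E)| <= `|al| * `|be|.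
Proof. by rewrite (le_trans (pt_map_norm _ _ _))// ler_pM ?nat_norm. Qed.

Definition ptensor_map : mor (ptensor xi ze) (ptensor xi' ze') :=
  mk_nat ptensor_map_natural (mulr_ge0 (normr_ge0 al) (normr_ge0 be))
    ptensor_map_bound.

Lemma ptensor_map_norm : `|ptensor_map| <= `|al| * `|be|.
Proof. by apply: nat_norm_le; [rewrite mulr_ge0|exact: ptensor_map_bound]. Qed.

End TensorMap.

Lemma ptensor_map_id xi ze : ptensor_map (idm xi) (idm ze) = idm (ptensor xi ze).
Proof. by apply: nat_eq => E; exact: pt_map_id. Qed.

Lemma ptensor_map_comp (xi xi' xi'' ze ze' ze'' : PShv)
    (al' : mor xi' xi'') (al : mor xi xi') (be' : mor ze' ze'') (be : mor ze ze') :
  ptensor_map (al' ∘ al) (be' ∘ be) = ptensor_map al' be' ∘ ptensor_map al be.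
Proof. by apply: nat_eq => E; exact: pt_map_comp. Qed.

Definition stensor (xi ze : Shv) : Shv := r (ptensor (sval xi) (sval ze)).

Definition stensor_map (xi xi' ze ze' : Shv) (al : mor xi xi') (be : mor ze ze') :
    mor (stensor xi ze) (stensor xi' ze') :=
  bf_map r (ptensor_map al be).

Lemma stensor_map_norm (xi xi' ze ze' : Shv) (al : mor xi xi') (be : mor ze ze') :
  `|stensor_map al be| <= `|al| * `|be|.
Proof. exact: (le_trans (bf_map_norm _ _) (ptensor_map_norm _ _)). Qed.

Lemma stensor_map_id xi ze : stensor_map (idm xi) (idm ze) = idm (stensor xi ze).
Proof. by rewrite -(bf_idm r) -ptensor_map_id. Qed.

Lemma stensor_map_comp (xi xi' xi'' ze ze' ze'' : Shv)
    (al' : mor xi' xi'') (al : mor xi xi') (be' : mor ze' ze'') (be : mor ze ze') :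
  stensor_map (al' ∘ al) (be' ∘ be) = stensor_map al' be' ∘ stensor_map al be.
Proof. by rewrite /stensor_map /bf_map -bf_comp -ptensor_map_comp. Qed.

Definition chi : pofunctor leΩ Shv := pf_compose r yoneda.

End Tensor.

Section Cosheaves.
Variable A : ban_cat K.

Definition is_coproduct (J : Type) (a : J -> A) (S : A)
    (inj : forall j, mor (a j) S) :=
  forall b : A,
    exists2 c : @mor K Ban (mor S b) (ban_prod (fun j => mor (a j) b)),
      forall f j, bcoord (bapply c f) j = f ∘ inj j & isometric_iso c.

Definition is_cosheaf (mu : pofun_cat leΩ A) :=
  forall (E : Ω) (n : nat) (P : 'I_n -> Ω) (hP : is_partition E P),
    exists (S : A) (inj : forall i, mor (mu (P i)) S),
      is_coproduct inj /\
      exists2 c : mor S (mu E),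
        forall i, c ∘ inj i = po_map mu (partition_le hP i : leΩ (P i) E) &
        isometric_iso c.

Definition CoShv : ban_cat K := fullcat is_cosheaf.

Definition downset (E : Ω) := {F : Ω | (F <= E)%O}.
Definition le_downset (E : Ω) : rel (downset E) := fun F G => (sval F <= sval G)%O.

Program Definition restr (E : Ω) (mu : pofun_cat leΩ A) :
    pofun_cat (@le_downset E) A :=
  @POFunctor K (downset E) (@le_downset E) A (fun F => mu (sval F))
    (fun F G h => po_map mu (h : leΩ (sval F) (sval G))) _ _ _.
Next Obligation. by move=> *; exact: po_contr. Qed.
Next Obligation. by move=> *; exact: po_id. Qed.
Next Obligation. by move=> *; exact: po_comp. Qed.

Definition downset_incl (E E' : Ω) (h : (E' <= E)%O) (F : downset E') : downset E :=
  exist _ (sval F) (le_trans (svalP F) h).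

Section HomPresheaf.
Variables mu nu : pofun_cat leΩ A.

Lemma nat_restrict_natural E E' (h : (E' <= E)%O)
    (eta : mor (restr E mu) (restr E nu)) :
  @is_natural K _ (@le_downset E') A (restr E' mu) (restr E' nu)
    (fun F => nat_at eta (downset_incl h F)).
Proof.
by move=> F G FG; exact: (nat_natural eta (FG : le_downset (downset_incl h F) (downset_incl h G))).
Qed.

Definition nat_restrict E E' (h : (E' <= E)%O)
    (eta : mor (restr E mu) (restr E nu)) :
  mor (restr E' mu) (restr E' nu) :=
  mk_nat (nat_restrict_natural h eta) (normr_ge0 eta)
    (fun F => nat_norm eta (downset_incl h F)).

Lemma nat_restrict_linear E E' (h : (E' <= E)%O) : linear (@nat_restrict E E' h).
Proof. by move=> k f g; apply: nat_eq => F; rewrite nat_lin [LHS]nat_lin. Qed.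

Lemma nat_restrict_bound E E' (h : (E' <= E)%O) eta :
  `|@nat_restrict E E' h eta| <= 1 * `|eta|.
Proof. by rewrite mul1r; apply: nat_norm_le => // F; exact: (nat_norm eta (downset_incl h F)). Qed.

Program Definition hom_presheaf : PShv :=
  @POFunctor K Ω geΩ Ban (fun E => @mor K (pofun_cat _ A) (restr E mu) (restr E nu))
    (fun E E' h => mk_blin (nat_restrict_linear (h : (E' <= E)%O)) ler01
                     (nat_restrict_bound h)) _ _ _.
Next Obligation.
by move=> E E' h; apply: blin_norm_le => // x; exact: nat_restrict_bound.
Qed.
Next Obligation.
move=> E h; apply: app_eq => eta; apply: nat_eq => -[F FE] /=.
by congr (nat_at eta (exist _ F _)); exact: bool_irrelevance.
Qed.
Next Obligation.
move=> E E' E'' h h' h''; apply: app_eq => eta; apply: nat_eq => -[F FE] /=.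
by congr (nat_at eta (exist _ F _)); exact: bool_irrelevance.
Qed.

End HomPresheaf.

Lemma restrict_map_natural (F G : pofun_cat leΩ A) (E : Ω) (al : mor F G) :
  @is_natural K _ (@le_downset E) A (restr E F) (restr E G)
    (fun H => nat_at al (sval H)).
Proof. by move=> H H' h; exact: (nat_natural al (h : leΩ _ _)). Qed.

Definition restrict_map (F G : pofun_cat leΩ A) (E : Ω) (al : mor F G) :
    mor (restr E F) (restr E G) :=
  mk_nat (@restrict_map_natural F G E al) (normr_ge0 al)
    (fun H => nat_norm al (sval H)).

Lemma restrict_map_norm (F G : pofun_cat leΩ A) (E : Ω) (al : mor F G) :
  `|restrict_map E al| <= `|al|.
Proof. by apply: nat_norm_le => // H; exact: (nat_norm al (sval H)). Qed.

Section HomPresheafMap.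
Variables (mu mu' nu nu' : pofun_cat leΩ A).
Variables (ga : mor mu' mu) (be : mor nu nu').

Lemma hom_presheaf_map_linear E :
  linear (fun eta : mor (restr E mu) (restr E nu) =>
    restrict_map E be ∘ eta ∘ restrict_map E ga).
Proof. by move=> k f g; rewrite comp_linr comp_linl. Qed.

Lemma hom_presheaf_map_bound E (eta : mor (restr E mu) (restr E nu)) :
  `|restrict_map E be ∘ eta ∘ restrict_map E ga| <= (`|be| * `|ga|) * `|eta|.
Proof.
rewrite (le_trans (norm_comp _ _))// mulrAC ler_pM ?restrict_map_norm//.
by rewrite (le_trans (norm_comp _ _))// ler_wpM2r ?restrict_map_norm.
Qed.

Definition hom_presheaf_map_at E :
    @mor K Ban (hom_presheaf mu nu E) (hom_presheaf mu' nu' E) :=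
  mk_blin (@hom_presheaf_map_linear E) (mulr_ge0 (normr_ge0 be) (normr_ge0 ga))
    (@hom_presheaf_map_bound E).

Lemma hom_presheaf_map_natural :
  @is_natural K Ω geΩ Ban (hom_presheaf mu nu) (hom_presheaf mu' nu')
    hom_presheaf_map_at.
Proof. by move=> E E' h; apply: app_eq => eta; apply: nat_eq. Qed.

Lemma hom_presheaf_map_at_norm E : `|hom_presheaf_map_at E| <= `|be| * `|ga|.
Proof.
by apply: blin_norm_le => [|eta]; [rewrite mulr_ge0|exact: hom_presheaf_map_bound].
Qed.

Definition hom_presheaf_map : mor (hom_presheaf mu nu) (hom_presheaf mu' nu') :=
  mk_nat hom_presheaf_map_natural (mulr_ge0 (normr_ge0 be) (normr_ge0 ga))
    hom_presheaf_map_at_norm.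

End HomPresheafMap.

Section Integral.
Variables (T : projective_tensor K) (r : reflection is_sheaf).

(* A cocontinuous extension of mu along [chi], i.e. a functor xi |-> int xi dmu.
   It is unique up to unique isomorphism. *)
Record integral (mu : CoShv) := Integral {
  int_fun :> bfunctor Shv A;
  int_cocontinuous : cocontinuous int_fun;
  int_chi : @mor K (pofun_cat leΩ A) (pf_compose int_fun (chi r)) (sval mu);
  int_chi_iso : isometric_iso int_chi }.

(* t : I -> I' is the transformation of integrals induced by ga : mu -> mu';
   by cocontinuity its values on the [chi r E] determine it. *)
Definition integral_map (mu mu' : CoShv) (I : integral mu) (I' : integral mu')
    (ga : mor mu mu') (t : bnat I I') :=
  forall E : Ω, nat_at (int_chi I') E ∘ t (chi r E) =
                nat_at (ga : @mor K (pofun_cat leΩ A) _ _) E ∘ nat_at (int_chi I) E.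

Program Definition indefinite_integral (I : bfunctor Shv A) (xi : Shv) :
    pofun_cat leΩ A :=
  @POFunctor K Ω leΩ A (fun E => I (stensor T r (chi r E) xi))
    (fun E F h => bf_map I (stensor_map T r (po_map (chi r) h) (idm xi))) _ _ _.
Next Obligation.
move=> I xi E F h; rewrite (le_trans (bf_map_norm _ _))//.
by rewrite (le_trans (stensor_map_norm _ _ _ _))// mulr_ile1 ?po_contr ?norm_idm.
Qed.
Next Obligation. move=> I xi E h; cbv beta.
by rewrite (po_id (chi r) h) stensor_map_id /bf_map bf_idm. Qed.
Next Obligation.
move=> I xi E F G h h' h''; cbv beta; rewrite (po_comp (chi r) h h' h'').
by rewrite -[in LHS](comp1f (idm xi)) stensor_map_comp /bf_map bf_comp.
Qed.

Section IndefiniteIntegralMaps.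
Variables (I I' : bfunctor Shv A) (xi xi' : Shv).

Lemma indefinite_integral_map_natural (al : mor xi xi') :
  @is_natural K Ω leΩ A (indefinite_integral I xi) (indefinite_integral I xi')
    (fun E => bf_map I (stensor_map T r (idm (chi r E)) al)).
Proof.
move=> E F h.
change (bf_map I (stensor_map T r (po_map (chi r) h) (idm xi'))
          ∘ bf_map I (stensor_map T r (idm (chi r E)) al) =
        bf_map I (stensor_map T r (idm (chi r F)) al)
          ∘ bf_map I (stensor_map T r (po_map (chi r) h) (idm xi))).
by rewrite -!(bf_mapM I) -!stensor_map_comp !comp1f !compf1.
Qed.

Lemma indefinite_integral_map_bound (al : mor xi xi') E :
  `|bf_map I (stensor_map T r (idm (chi r E)) al)| <= `|al|.
Proof.
rewrite (le_trans (bf_map_norm _ _))// (le_trans (stensor_map_norm _ _ _ _))//.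
by rewrite ler_piMl ?norm_idm.
Qed.

Definition indefinite_integral_map (al : mor xi xi') :
    mor (indefinite_integral I xi) (indefinite_integral I xi') :=
  mk_nat (indefinite_integral_map_natural al) (normr_ge0 al)
    (indefinite_integral_map_bound al).

Lemma indefinite_integral_trans_natural (t : bnat I I') :
  @is_natural K Ω leΩ A (indefinite_integral I xi) (indefinite_integral I' xi)
    (fun E => t (stensor T r (chi r E) xi)).
Proof. by move=> E F h; exact: bn_natural. Qed.

Lemma indefinite_integral_trans_bound (t : bnat I I') E :
  `|t (stensor T r (chi r E) xi)| <= `|sval (cid (bn_bounded t))|.
Proof.
case: cid => M tM /=; rewrite (le_trans (tM _))// real_ler_norm//.
by rewrite ger0_real// (le_trans _ (tM (stensor T r (chi r E) xi))).
Qed.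

Definition indefinite_integral_trans (t : bnat I I') :
    mor (indefinite_integral I xi) (indefinite_integral I' xi) :=
  mk_nat (indefinite_integral_trans_natural t) (normr_ge0 _)
    (indefinite_integral_trans_bound t).

End IndefiniteIntegralMaps.
End Integral.
End Cosheaves.
End Sheaves.

(* Main.v *)
(** For a sheaf xi the co-Yoneda lemma makes chi(E) ⊗ xi the colimit of the
    chi(F), F <= E, weighted by xi(F): by Yoneda a cocone with vertex a sheaf ze
    is a family of maps xi(F) -> ze(F) natural in F <= E, i.e. a section over E
    of the internal hom [xi, ze]; that presheaf is a sheaf, so such a section is
    a map chi(E) -> [xi, ze], and currying turns it into a map
    chi(E) ⊗ xi -> ze. The integral preserves this colimit, hence
      Hom(int_E xi dmu, b) = Nat_{F <= E} (xi(F), Hom(mu(F), b))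
    isometrically. The right side is the value at E of [xi, Hom(mu(-), b)], a
    sheaf because mu is a cosheaf; so E |-> int_E xi dmu is a cosheaf. For b = nu(E)
    it lets one pass between a map f : int xi dmu -> nu and the map
    xi -> CoShv(mu, nu) sending x in xi(E) to the transformation with components
      mu(F) = int chi(F) dmu -> int chi(F) ⊗ xi dmu -> nu(F),
    where the first arrow is the colimit injection at x|_F. *)
Require Import Defs.
From mathcomp Require Import all_boot all_order all_algebra.
From mathcomp Require Import boolp.
From mathcomp Require Import topology normedtype.

Set Implicit Arguments.
Unset Strict Implicit.
Unset Printing Implicit Defensive.

Import Order.TTheory GRing.Theory Num.Theory.
Local Open Scope ring_scope.

(** * Banach spaces and gluing *)

Section Banach.
Variable K : scalar_field.
Local Notation Ban := (Ban K).

(** Choosing for each y a preimage of norm at most that of y makes the inverse contractive; its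
    linearity follows from injectivity of f. *)
Lemma ban_iso (X Y : Ban) (f : mor X Y) : `|f| <= 1 ->
    (forall x y, bapply f x = bapply f y -> x = y) ->
    (forall y, exists2 x, bapply f x = y & `|x| <= `|y|) ->
  isometric_iso f.
Proof.
move=> f1 fI fS; pose g y := s2val (cid2 (fS y)).
have gK y : bapply f (g y) = y by rewrite /g; case: cid2.
have gn y : `|g y| <= 1 * `|y| by rewrite mul1r /g; case: cid2.
have gl : linear g by move=> k x y; apply: fI; rewrite app_linear !gK.
exists (mk_blin gl ler01 gn : @mor K Ban Y X); split=> //.
- by apply: app_eq => x; apply: fI; rewrite app_comp; exact: gK.
- by apply: app_eq => y; exact: gK.
- exact: blin_norm_le.
Qed.

Section Products.
Variables (J : Type) (B : J -> Ban).

Definition mk_prod (x : forall j, B j) (M : K) (M0 : 0 <= M)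
    (xM : forall j, `|x j| <= M * 1) : ban_prod B :=
  @Ell K (prod_space B) x (ex_intro _ M (conj M0 xM)) I.

Lemma bcoord_norm (x : ban_prod B) j : `|bcoord x j| <= `|x|.
Proof. by have := @ell_norm_pt K (prod_space B) x j; rewrite mulr1. Qed.

Lemma ban_prod_norm_le (x : ban_prod B) M : 0 <= M ->
  (forall j, `|bcoord x j| <= M) -> `|x| <= M.
Proof.
by move=> M0 xM; apply: (@ell_norm_le K (prod_space B)) => // j; rewrite mulr1.
Qed.

Lemma ban_prod_eq (x y : ban_prod B) : (forall j, bcoord x j = bcoord y j) -> x = y.
Proof. exact: (@ell_eq K (prod_space B)). Qed.

Lemma ban_prod_pair (X : Ban) (p : forall j, mor X (B j)) (M : K) : 0 <= M ->
    (forall j, `|p j| <= M) ->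
  exists2 c : @mor K Ban X (ban_prod B), `|c| <= M &
    forall x j, bcoord (bapply c x) j = bapply (p j) x.
Proof.
move=> M0 pM.
have pxM x j : `|bapply (p j) x| <= M * `|x| * 1.
  by rewrite mulr1 (le_trans (app_norm _ _))// ler_wpM2r.
pose c x := mk_prod (mulr_ge0 M0 (normr_ge0 x)) (pxM x).
have cl : linear c.
  move=> k x y; apply: ban_prod_eq => j.
  by rewrite /bcoord ellD ellZ; exact: app_linear.
have cM x : `|c x| <= M * `|x|.
  apply: ban_prod_norm_le => [|j]; first by rewrite mulr_ge0.
  by have := pxM x j; rewrite mulr1.
exists (mk_blin cl M0 cM : @mor K Ban X (ban_prod B)) => //.
exact: blin_norm_le.
Qed.

(** The working criterion for sheaf and coproduct conditions: the [p j] are jointly injective, and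
    bounded families amalgamate without loss in the bound. *)
Lemma ban_prod_iso (X : Ban) (p : forall j, mor X (B j)) :
    (forall j, `|p j| <= 1) ->
    (forall x y, (forall j, bapply (p j) x = bapply (p j) y) -> x = y) ->
    (forall (z : forall j, B j) M, 0 <= M -> (forall j, `|z j| <= M) ->
       exists2 x, forall j, bapply (p j) x = z j & `|x| <= M) ->
  exists2 c : @mor K Ban X (ban_prod B),
    forall x j, bcoord (bapply c x) j = bapply (p j) x & isometric_iso c.
Proof.
move=> p1 pI pS; have [c c1 cE] := ban_prod_pair ler01 p1.
exists c => //; apply: ban_iso => // [x y cxy|y].
  by apply: pI => j; rewrite -!cE cxy.
have [x xE xn] := pS (bcoord y) _ (normr_ge0 y) (bcoord_norm y).
by exists x => //; apply: ban_prod_eq => j; rewrite cE.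
Qed.

End Products.
End Banach.

(** * Gluing of maps out of the values of a cosheaf *)

Section Gluing.
Variables (K : scalar_field) (d : Order.disp_t) (Ω : ctbDistrLatticeType d).
Local Notation Ban := (Ban K).
Local Notation leΩ := (@leΩ d Ω).
Local Notation geΩ := (@geΩ d Ω).

Lemma po_map_irr (T : Type) (le : rel T) (A : ban_cat K) (F : pofunctor le A)
  x y (h h' : le x y) : po_map F h = po_map F h'.
Proof. by congr po_map; exact: bool_irrelevance. Qed.

Section Cosheaf.
Variable A : ban_cat K.
Implicit Types mu nu : pofunctor leΩ A.

(* The isometry Hom(mu(E), b) = prod_i Hom(mu(P i), b), without reference to a
   coproduct; unlike in [is_partition], some of the P i may be zero. *)
Definition glues_along mu (E : Ω) n (P : 'I_n -> Ω) :=
  forall (b : A) (f : forall i, mor (mu (P i)) b) (M : K), 0 <= M ->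
    (forall i, `|f i| <= M) ->
  exists g : mor (mu E) b, [/\ `|g| <= M,
    forall i (h : leΩ (P i) E), g ∘ po_map mu h = f i &
    forall g', (forall i (h : leΩ (P i) E), g' ∘ po_map mu h = f i) -> g' = g].

Definition glues mu := forall (E : Ω) n (P : 'I_n -> Ω),
  is_partition E P -> glues_along mu E P.

(** The isometries from Hom(S, b) to the product and from S to mu(E) have contractive inverses;
    gluing first over S and then transporting to mu(E) therefore keeps the bound M. *)
Lemma cosheaf_glues mu : is_cosheaf mu -> glues mu.
Proof.
move=> muC E n P hP b f M M0 fM.
have [S [inj [Sco [c cE [c' [c'K cK c1 c'1]]]]]] := muC E n P hP.
have [k kE [k' [k'K kK k1 k'1]]] := Sco b.
have fM1 i : `|f i| <= M * 1 by rewrite mulr1.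
pose y : ban_prod (fun i => mor (mu (P i)) b) := mk_prod M0 fM1.
have ky s : (forall i, s ∘ inj i = f i) -> s = bapply k' y.
  move=> sf; rewrite -[LHS](app_idm (s : (mor S b : Ban))) -k'K app_comp; congr bapply.
  by apply: ban_prod_eq => i; rewrite kE sf.
have k'y i : bapply k' y ∘ inj i = f i.
  by rewrite -kE -app_comp kK.
have yM : `|y| <= M by apply: ban_prod_norm_le.
exists (bapply k' y ∘ c'); split.
- rewrite (le_trans (norm_comp _ _))// -[M]mulr1 ler_pM//.
  by rewrite (le_trans (app_norm1 _ _)).
- move=> i h; rewrite (po_map_irr mu _ (partition_le hP i)) -cE.
  by rewrite Defs.compA -(Defs.compA _ c' c) c'K compf1 k'y.
- move=> g' g'f; rewrite -(ky (g' ∘ c)); first by rewrite -Defs.compA cK compf1.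
  by move=> i; rewrite -Defs.compA cE g'f.
Qed.

(** Gluing exhibits mu(E) itself as the coproduct, so the comparison map can be taken to be the
    identity. *)
Lemma glues_cosheaf mu : glues mu -> is_cosheaf mu.
Proof.
move=> muG E n P hP.
exists (mu E), (fun i => po_map mu (partition_le hP i : leΩ (P i) E)); split.
  move=> b.
  pose p i (f : mor (mu E) b) := f ∘ po_map mu (partition_le hP i : leΩ (P i) E).
  have pl i : linear (p i) by move=> k f g; exact: comp_linl.
  have p1 i (f : mor (mu E) b) : `|p i f| <= 1 * `|f|.
    by rewrite mul1r (le_trans (norm_comp _ _))// ler_piMr ?po_contr.
  apply: (ban_prod_iso (X := mor (mu E) b)
    (p := fun i => mk_blin (pl i) ler01 (p1 i) : @mor K Ban _ (mor (mu (P i)) b))).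
  - by move=> i; apply: blin_norm_le => // f; exact: p1.
  - move=> f g fg.
    have [|w [_ _ wU]] := muG E n P hP b (fun i => p i f) `|f| (normr_ge0 f).
      by move=> i; have := p1 i f; rewrite mul1r.
    have -> : f = w by apply: wU => i h; rewrite (po_map_irr mu h (partition_le hP i)).
    symmetry; apply: wU => i h; rewrite (po_map_irr mu h (partition_le hP i)).
    by symmetry; exact: (fg i).
  - move=> z M M0 zM; have [w [wM wE _]] := muG E n P hP b z M M0 zM.
    by exists w => // i; exact: wE.
exists (idm (mu E)); first by move=> i; rewrite comp1f.
by exists (idm _); rewrite comp1f norm_idm.
Qed.

(** The empty family partitions the bottom element, so both maps glue the empty family of maps. *)
Lemma glues_bot mu (b : A) (f g : mor (mu \bot%O) b) : glues mu -> f = g.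
Proof.
move=> muG; pose P (i : 'I_0) : Ω := \bot%O.
have hP : is_partition \bot%O P.
  by split; [case|case|rewrite big_ord0].
have [|w [_ _ wU]] := muG _ _ _ hP b (fun i => 0) 0 (lexx 0); first by case.
by transitivity w; [apply: wU; case|symmetry; apply: wU; case].
Qed.

(** Intersecting a partition with a smaller element can produce zero pieces. Discarding them leaves
    a true partition, and by [glues_bot] the discarded pieces impose no condition. *)
Lemma glues_cover mu (E : Ω) n (Q : 'I_n -> Ω) : glues mu ->
    (forall i j, i != j -> (Q i `&` Q j)%O = \bot%O) ->
    (\join_(i < n) Q i)%O = E ->
  glues_along mu E Q.
Proof.
move=> muG Qd QE b f M M0 fM; pose D := [pred i | Q i != \bot%O].
pose P (k : 'I_#|D|) := Q (enum_val k).
have hP : is_partition E P.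
  split=> [k|k l kl|]; first by have := enum_valP k.
    by apply: Qd; rewrite (inj_eq enum_val_inj).
  rewrite -QE -(big_enum_val (A := D) Q) /= [RHS](bigID D) /= [X in _ = (_ `|` X)%O]big1 ?joinx0//.
  by move=> i; rewrite negbK => /eqP.
have [g [gM gf gU]] := muG E _ P hP b (fun k => f (enum_val k)) M M0 (fun k => fM _).
exists g; split=> // [i h|g' g'f]; last by apply: gU => k h; exact: g'f.
case: (boolP (i \in D)) => iD.
  have [k ki] : exists k : 'I_#|D|, enum_val k = i.
    by exists (enum_rank_in iD i); rewrite enum_rankK_in.
  by move: h; rewrite -ki => h; exact: (gf k h).
have Q0 : Q i = \bot%O by apply/eqP; move: iD; rewrite inE negbK.
by move: (f i) h; rewrite Q0 => fi h; exact: glues_bot.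
Qed.

End Cosheaf.
End Gluing.

(** * The hom presheaf of cosheaves *)

Section Sheaf.
Variables (K : scalar_field) (d : Order.disp_t) (Ω : ctbDistrLatticeType d).
Local Notation Ban := (Ban K).
Local Notation leΩ := (@leΩ d Ω).
Local Notation geΩ := (@geΩ d Ω).

(** Viewing a presheaf as a covariant functor to the opposite category makes the results on gluing
    for cosheaves available for sheaves. *)
Program Definition op_pofun (A : ban_cat K) (X : pofunctor geΩ A) :
    pofunctor leΩ (opcat A) :=
  @POFunctor K Ω leΩ (opcat A) X (fun E F h => po_map X (h : geΩ F E)) _ _ _.
Next Obligation. by move=> A X E F h; exact: (po_contr X (h : geΩ F E)). Qed.
Next Obligation. by move=> A X E h; exact: (po_id X (h : geΩ E E)). Qed.
Next Obligation.
move=> A X E F G h h' h''.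
exact: (po_comp X (h' : geΩ G F) (h : geΩ F E) (h'' : geΩ G E)).
Qed.

Lemma glues_along_eq (A : ban_cat K) (mu : pofunctor leΩ A) E n
    (P : 'I_n -> Ω) (b : A) (g g' : mor (mu E) b) :
    glues_along mu E P ->
    (forall i (h : leΩ (P i) E), g ∘ po_map mu h = g' ∘ po_map mu h) ->
    (forall i, (P i <= E)%O) -> g = g'.
Proof.
move=> muG gg' PE; pose f i := g ∘ po_map mu (PE i : leΩ (P i) E).
have [|w [_ _ wU]] := muG b f `|g| (normr_ge0 g).
  by move=> i; rewrite (le_trans (norm_comp _ _))// ler_piMr ?po_contr.
transitivity w; [|symmetry]; apply: wU => i h;
  by rewrite ?gg' /f (po_map_irr mu h (PE i)) -?gg'.
Qed.

(** A map out of ze(E) in the opposite category is an operator from b to ze(E); since ze(E) is the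
    product of the ze(P i), bounded families of operators pair into one. *)
Lemma sheaf_glues (ze : PShv K Ω) : is_sheaf ze -> glues (op_pofun ze).
Proof.
move=> zeS E n P hP b f M M0 fM.
have [c cE [c' [c'K cK c1 c'1]]] := zeS E n P hP.
have [p pM pE] := @ban_prod_pair K _ (fun i => ze (P i)) b f M M0 fM.
pose g : @mor K Ban b (ze E) := @mcomp K Ban _ _ _ c' p.
have gM : `|g| <= M by rewrite (le_trans (norm_comp _ _))// -[M]mul1r ler_pM.
exists g; split=> //.
- move=> i h; apply: (@app_eq K b (ze (P i))) => x; rewrite -pE.
  transitivity (bcoord (bapply (@mcomp K Ban _ _ _ c (@mcomp K Ban _ _ _ c' p)) x) i).
    rewrite app_comp cE; apply: (congr1 (fun k => bapply k (bapply g x))).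
    exact: (po_map_irr ze).
  by rewrite Defs.compA cK comp1f.
- move=> g' g'f; apply: (@app_eq K b (ze E)) => x.
  rewrite -[LHS](app_idm (X := ze E)) -c'K !app_comp; congr bapply.
  by apply: ban_prod_eq => i; rewrite cE pE -(g'f i (partition_le hP i)).
Qed.

Lemma sheaf_of_gluing (xi : PShv K Ω) :
    (forall E n (P : 'I_n -> Ω), is_partition E P ->
       forall (x : forall i, xi (P i)) M, 0 <= M -> (forall i, `|x i| <= M) ->
       exists2 y, forall i (h : geΩ E (P i)), bapply (po_map xi h) y = x i &
         `|y| <= M) ->
    (forall E n (P : 'I_n -> Ω), is_partition E P -> forall x y : xi E,
       (forall i (h : geΩ E (P i)),
          bapply (po_map xi h) x = bapply (po_map xi h) y) -> x = y) ->
  is_sheaf xi.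
Proof.
move=> xiG xiU E n P hP.
apply: (ban_prod_iso (X := xi E)
  (p := fun i => po_map xi (partition_le hP i : geΩ E (P i)))).
- by move=> i; exact: po_contr.
- move=> x y xy; apply: (xiU E n P hP) => i h.
  by rewrite (po_map_irr xi h (partition_le hP i)).
- move=> z M M0 zM; have [y yE yM] := xiG E n P hP z M M0 zM.
  by exists y.
Qed.

Lemma sheaf_glue (xi : PShv K Ω) : is_sheaf xi ->
  forall E n (P : 'I_n -> Ω), is_partition E P ->
  forall (x : forall i, xi (P i)) M, 0 <= M -> (forall i, `|x i| <= M) ->
  exists2 y, forall i (h : geΩ E (P i)), bapply (po_map xi h) y = x i & `|y| <= M.
Proof.
move=> xiS E n P hP x M M0 xM.
have [c cE [c' [_ cK _ c'1]]] := xiS E n P hP.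
have xM1 i : `|x i| <= M * 1 by rewrite mulr1.
pose z : ban_prod (fun i => xi (P i)) := mk_prod M0 xM1.
exists (bapply c' z) => [i h|].
  by rewrite (po_map_irr xi h (partition_le hP i)) -cE -app_comp cK.
by rewrite (le_trans (app_norm1 _ c'1))//; exact: ban_prod_norm_le.
Qed.

Lemma sheaf_eq (xi : PShv K Ω) : is_sheaf xi ->
  forall E n (P : 'I_n -> Ω), is_partition E P -> forall x y : xi E,
  (forall i (h : geΩ E (P i)),
     bapply (po_map xi h) x = bapply (po_map xi h) y) -> x = y.
Proof.
move=> xiS E n P hP x y xy.
have [c cE [c' [c'K _ _ _]]] := xiS E n P hP.
rewrite -[x]app_idm -[y]app_idm -c'K !app_comp; congr bapply.
by apply: ban_prod_eq => i; rewrite !cE.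
Qed.

Lemma meet_cover (E F : Ω) n (P : 'I_n -> Ω) : is_partition E P -> (F <= E)%O ->
  (forall i j, i != j -> (F `&` P i `&` (F `&` P j))%O = \bot%O) /\
  (\join_(i < n) (F `&` P i))%O = F.
Proof.
case=> _ Pd PE FE; split=> [i j ij|]; first by rewrite meetACA Pd ?meetx0.
rewrite -(big_morph _ (meetUr F) (meetx0 F)) PE; exact/meet_idPl.
Qed.

Section HomSheaf.
Variables (A : ban_cat K) (mu nu : pofun_cat leΩ A).
Hypothesis muG : glues mu.

(** For F <= E, the object mu(F) is glued from the mu(F ∧ P i), so the component at F of a
    transformation over E is determined by its components at the pieces F ∧ P i. Local
    transformations thus amalgamate, with the same bound. *)
Lemma hom_presheaf_sheaf : is_sheaf (hom_presheaf mu nu).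
Proof.
have cov E F n (P : 'I_n -> Ω) : is_partition E P -> (F <= E)%O ->
    glues_along mu F (fun i => (F `&` P i)%O).
  by move=> hP FE; have [Qd QE] := meet_cover hP FE; exact: glues_cover.
apply: sheaf_of_gluing => E n P hP.
- move=> x M M0 xM.
  pose Qd (F : Ω) i : downset (P i) := exist _ (F `&` P i)%O (leIr _ _).
  (* The prescribed value on the i-th piece of F: the component of [x i] there, followed by the
     transition map of nu into nu(F). *)
  pose f (F : Ω) i : mor (mu (F `&` P i)%O) (nu F) :=
    po_map nu (leIl F (P i) : leΩ _ _) ∘ nat_at (x i) (Qd F i).
  have fM F i : `|f F i| <= M.
    rewrite (le_trans (norm_comp _ _))// -[M]mul1r ler_pM ?po_contr//.
    exact: (le_trans (nat_norm _ _) (xM i)).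
  pose G (F : downset E) := cid (cov E _ n P hP (svalP F) _ (f (sval F)) M M0 (fM _)).
  pose eta F := sval (G F).
  have etaM F : `|eta F| <= M by rewrite /eta; case: (G F) => g [].
  have etaE F i (h : leΩ (sval F `&` P i)%O (sval F)) :
      eta F ∘ po_map mu h = f (sval F) i by rewrite /eta; case: (G F) => g [].
  have etaN : @is_natural K _ (@le_downset d Ω E) A (restr E mu) (restr E nu) eta.
    (* Tested on the pieces of F, naturality reduces to that of [x i] along F ∧ P i <= H ∧ P i. *)
    move=> F H h; apply: (glues_along_eq (cov E _ n P hP (svalP F))).
      move=> i hi; have FH : leΩ (sval F `&` P i)%O (sval H `&` P i)%O by exact: leI2.
      have hI := leIl (sval H) (P i) : leΩ _ _.
      rewrite -!Defs.compA etaE /= -(po_comp mu _ _ (le_trans hi h)).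
      rewrite (po_comp mu FH hI) Defs.compA etaE.
      rewrite -Defs.compA [X in _ = _ ∘ X](_ : _ =
        po_map nu FH ∘ nat_at (x i) (Qd (sval F) i)); last first.
        by symmetry; exact: (nat_natural (x i) (FH : le_downset (Qd (sval F) i) (Qd (sval H) i))).
      rewrite /f !Defs.compA; congr (_ ∘ _).
      by rewrite -(po_comp nu _ _ (le_trans hi h)) -(po_comp nu _ _ (le_trans hi h)).
    by move=> i; exact: leIl.
  exists (mk_nat etaN M0 etaM); last exact: nat_norm_le.
  move=> i h; apply: nat_eq => -[F FP].
  set F' : downset E := downset_incl h (exist _ F FP).
  change (eta F' = nat_at (x i) (exist _ F FP)).
  (* Here F <= P i, so F and F ∧ P i lie below each other. Inserting the round trip, which is the
     identity of mu(F), reduces the claim to the piece F ∧ P i. *)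
  have FQ : leΩ F (F `&` P i)%O by rewrite /Defs.leΩ lexI lexx.
  pose QF : leΩ (F `&` P i)%O F := leIl F (P i).
  have muI : po_map mu QF ∘ po_map mu FQ = idm _.
    by rewrite -(po_comp mu _ _ (lexx F)) po_id.
  rewrite -[LHS]compf1 -[RHS]compf1 -muI !Defs.compA; congr (_ ∘ _).
  rewrite (etaE F').
  exact: (nat_natural (x i) (QF : le_downset (Qd F i) (exist _ F FP))).
- move=> x y xy; apply: nat_eq => F.
  apply: (glues_along_eq (cov E _ n P hP (svalP F))) => [i hi|i]; last exact: leIl.
  have FiE : ((sval F `&` P i) <= E)%O by rewrite (le_trans _ (svalP F))// leIl.
  pose Fi : downset E := exist _ (sval F `&` P i)%O FiE.
  have xE := nat_natural x (hi : le_downset Fi F).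
  have yE := nat_natural y (hi : le_downset Fi F).
  apply: (etrans (esym xE)); apply: etrans yE; congr (_ ∘ _).
  have := congr1 (fun z => nat_at z (exist _ (sval F `&` P i)%O (leIr _ _) : downset (P i)))
    (xy i (partition_le hP i)).
  rewrite /bapply /bapp /nat_at /= /downset_incl /=.
  by rewrite (bool_irrelevance (le_trans _ _) FiE).
Qed.

End HomSheaf.
End Sheaf.

(** * Weighted colimits over a preorder *)

Section Coefficients.
Variable K : scalar_field.
Local Notation Ban := (Ban K).

(** The default 0 in the zero space lets every vector be its coefficient times [indic_one], whatever
    b is. *)
Definition indic_one (b : bool) : indic K b :=
  match b with true => (1 : K^o) : scalar_ban K | false => 0 end.

Definition indic_coef (b : bool) : indic K b -> K :=
  match b with true => fun x => (x : K^o) | false => fun=> 0 end.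

Lemma indic_one_norm b : `|indic_one b| <= 1.
Proof. by case: b; rewrite /= ?normr0// normr1. Qed.

Lemma indic_coef_linear b k (x y : indic K b) :
  indic_coef (k *: x + y) = k * indic_coef x + indic_coef y.
Proof. by case: b x y => x y //=; rewrite mulr0 addr0. Qed.

Lemma indic_coef_norm b (x : indic K b) : `|indic_coef x| <= `|x|.
Proof. by case: b x => x //=; rewrite normr0. Qed.

Lemma indic_coef_one b : indic_coef (indic_one b) = b%:R.
Proof. by case: b. Qed.

Lemma indic_coefN b (x : indic K b) : ~ b -> indic_coef x = 0.
Proof. by case: b x => x // /(_ isT). Qed.

Lemma indic_coefE b (x : indic K b) : x = indic_coef x *: indic_one b.
Proof.
case: b x => x /=; first by rewrite /GRing.scale /= mulr1.
by apply: (@ell_eq K (prod_space (fun _ : void => scalar_ban K))); case.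
Qed.

Lemma indic_coefZ b (k : K) : indic_coef (k *: indic_one b) = k * b%:R.
Proof. by case: b => /=; rewrite ?mulr0// /GRing.scale. Qed.

End Coefficients.

Section Scaling.
Variables (K : scalar_field) (C : ban_cat K).

Lemma comp_Zl (a b c : C) k (g : mor b c) (f : mor a b) :
  (k *: g) ∘ f = k *: (g ∘ f).
Proof. by have := comp_linl k g 0 f; rewrite comp0l !addr0. Qed.

Lemma comp_Zr (a b c : C) k (g : mor b c) (f : mor a b) :
  g ∘ (k *: f) = k *: (g ∘ f).
Proof. by have := comp_linr k g f 0; rewrite comp0r !addr0. Qed.

Lemma app_Z (X Y : Ban K) (f : mor X Y) k x : bapply f (k *: x) = k *: bapply f x.
Proof. by have := app_linear f k x 0; rewrite addr0 [bapply f 0]bapp0 addr0. Qed.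

Lemma app_Zl (X Y : Ban K) k (f : mor X Y) x :
  bapply (k *: f) x = k *: bapply f x.
Proof. exact: (@ellZ K (blin_space X Y)). Qed.

End Scaling.

Section Composition.
Variables (K : scalar_field) (C : ban_cat K).
Local Notation Ban := (Ban K).

Lemma precomp_linear (a b c : C) (f : mor a b) : linear (fun g : mor b c => g ∘ f).
Proof. by move=> k g h; exact: comp_linl. Qed.

Lemma precomp_bound (a b c : C) (f : mor a b) (g : mor b c) :
  `|g ∘ f| <= `|f| * `|g|.
Proof. by rewrite mulrC norm_comp. Qed.

Definition precomp (a b c : C) (f : mor a b) : @mor K Ban (mor b c) (mor a c) :=
  mk_blin (@precomp_linear a b c f) (normr_ge0 f) (@precomp_bound a b c f).

Lemma precomp_norm (a b c : C) (f : mor a b) : `|precomp c f| <= `|f|.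
Proof. by apply: blin_norm_le => // g; exact: precomp_bound. Qed.

Lemma postcomp_linear (a b c : C) (g : mor b c) : linear (fun f : mor a b => g ∘ f).
Proof. by move=> k f h; exact: comp_linr. Qed.

Lemma postcomp_bound (a b c : C) (g : mor b c) (f : mor a b) :
  `|g ∘ f| <= `|g| * `|f|.
Proof. exact: norm_comp. Qed.

Definition postcomp (a b c : C) (g : mor b c) : @mor K Ban (mor a b) (mor a c) :=
  mk_blin (@postcomp_linear a b c g) (normr_ge0 g) (@postcomp_bound a b c g).

Lemma postcomp_norm (a b c : C) (g : mor b c) : `|postcomp a g| <= `|g|.
Proof. by apply: blin_norm_le => // f; exact: postcomp_bound. Qed.

End Composition.

Lemma op_compE (K : scalar_field) (C : ban_cat K) (a b c : opcat C)
    (g : mor b c) (f : mor a b) :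
  g ∘ f = @mcomp K C c b a f g.
Proof. by []. Qed.

Section FreeCategory.
Variables (K : scalar_field) (T : Type) (le : rel T).
Hypotheses (le_xx : reflexive le) (le_tr : transitive le).
Local Notation Ban := (Ban K).

(* The free Banach category on a preorder: K with basis the arrow x -> y if
   [le x y], and 0 otherwise. *)
Program Definition free_on : ban_cat_on K T :=
  @BanCatOn K T (fun x y => indic K (le x y)) (fun x => indic_one K (le x x))
    (fun x y z g f => (indic_coef g * indic_coef f) *: indic_one K (le x z))
    _ _ _ _ _ _ _.
Next Obligation.
by move=> x y z f k g h; rewrite indic_coef_linear mulrDl scalerDl scalerA mulrA.
Qed.
Next Obligation.
move=> x y z g k f h; rewrite indic_coef_linear mulrDr scalerDl scalerA.
by rewrite mulrCA.
Qed.
Next Obligation.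
move=> x y z g f; rewrite normrZ normrM -[leRHS]mulr1.
by rewrite ler_pM ?mulr_ge0 ?indic_one_norm// ler_pM ?indic_coef_norm.
Qed.
Next Obligation. by move=> x; exact: indic_one_norm. Qed.
Next Obligation.
move=> x y z t h g f; cbv beta; rewrite !indic_coefZ; congr (_ *: _).
have [xy|xy] := pselect (le x y); last by rewrite (indic_coefN f)// !(mul0r, mulr0).
have [yz|yz] := pselect (le y z); last by rewrite (indic_coefN g)// !(mul0r, mulr0).
have [zt|zt] := pselect (le z t); last by rewrite (indic_coefN h)// !(mul0r, mulr0).
by rewrite (le_tr xy yz) (le_tr yz zt) !mulr1 mulrA.
Qed.
Next Obligation.
by move=> x y f; cbv beta; rewrite indic_coef_one le_xx mul1r -indic_coefE.
Qed.
Next Obligation.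
by move=> x y f; cbv beta; rewrite indic_coef_one le_xx mulr1 -indic_coefE.
Qed.

Definition free_cat : small_ban_cat K := SmallBanCat free_on.

Section Extension.
Variables (A : ban_cat K) (X : pofunctor le A).

(** The default 0 is harmless: [po_map0] is used with a factor [indic_coef] that vanishes when
    [le x y] fails. *)
Definition po_map0 x y : mor (X x) (X y) :=
  if pselect (le x y) is left h then po_map X h else 0.

Lemma po_map0E x y (h : le x y) : po_map0 x y = po_map X h.
Proof. by rewrite /po_map0; case: pselect => // h'; exact: po_map_irr. Qed.

Lemma po_map0_norm x y : `|po_map0 x y| <= 1.
Proof. by rewrite /po_map0; case: pselect => h; rewrite ?normr0 ?po_contr. Qed.

Definition free_hom x y (f : indic K (le x y)) : mor (X x) (X y) :=
  indic_coef f *: po_map0 x y.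

Lemma free_hom_linear x y : linear (@free_hom x y).
Proof. by move=> k f g; rewrite /free_hom indic_coef_linear scalerDl scalerA. Qed.

Lemma free_hom_norm x y f : `|@free_hom x y f| <= 1 * `|f|.
Proof. by rewrite normrZ mulrC ler_pM ?po_map0_norm ?indic_coef_norm. Qed.

Program Definition free_functor : bfunctor free_cat A :=
  @BFunctor K free_cat A X
    (fun x y => mk_blin (@free_hom_linear x y) ler01 (@free_hom_norm x y)) _ _ _.
Next Obligation. by move=> x y; apply: blin_norm_le => // f; exact: free_hom_norm. Qed.
Next Obligation.
move=> x; change (free_hom (indic_one K (le x x)) = idm (X x)).
by rewrite /free_hom indic_coef_one le_xx scale1r (po_map0E (le_xx x)) po_id.
Qed.
Next Obligation.
move=> x y z g f.
change (free_hom ((indic_coef g * indic_coef f) *: indic_one K (le x z)) =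
  free_hom g ∘ free_hom f).
rewrite /free_hom comp_Zl comp_Zr scalerA indic_coefZ.
have [xy|xy] := pselect (le x y); last by rewrite (indic_coefN f)// !(mul0r, mulr0, scale0r).
have [yz|yz] := pselect (le y z); last by rewrite (indic_coefN g)// !(mul0r, mulr0, scale0r).
have xz := le_tr xy yz.
by rewrite xz mulr1 (po_map0E xy) (po_map0E yz) (po_map0E xz) (po_comp X xy yz xz).
Qed.

End Extension.

Program Definition free_weight (W : pofunctor le (opcat Ban)) :
    bfunctor (opcat free_cat) Ban :=
  @BFunctor K (opcat free_cat) Ban W
    (fun x y => bf_hom (free_functor W) y x) _ _ _.
Next Obligation. by move=> W x y; exact: (bf_contr (free_functor W)). Qed.
Next Obligation. by move=> W x; exact: (bf_idm (free_functor W)). Qed.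
Next Obligation.
move=> W x y z g f; rewrite op_compE; have := @bf_comp _ _ _ (free_functor W) z y x f g.
by rewrite op_compE.
Qed.

End FreeCategory.

(** * Colimits over a preorder and their preservation *)

Section OrderColimits.
Variables (K : scalar_field) (T : Type) (le : rel T).
Local Notation Ban := (Ban K).

Section Colimit.
Variables (A : ban_cat K) (X : pofunctor le A) (W : pofunctor le (opcat Ban)).

(* The elementary form of [is_wcocone] and [is_wcolim] over [free_on]. The weight
   is contravariant; taking it as a covariant functor to the opposite of [Ban]
   lets restrictions to downsets be formed by [restr]. *)
Definition po_cocone (a : A) (c : forall x, @mor K Ban (W x) (mor (X x) a)) :=
  forall x y (h : le x y) (w : W y),
    bapply (c x) (bapply (po_map W h : @mor K Ban (W y) (W x)) w) =
    bapply (c y) w ∘ po_map X h.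

Definition po_wcolim (L : A) (lam : forall x, @mor K Ban (W x) (mor (X x) L)) :=
  [/\ po_cocone lam, forall x, `|lam x| <= 1 &
    forall (a : A) (c : forall x, @mor K Ban (W x) (mor (X x) a)) (M : K),
      0 <= M -> po_cocone c -> (forall x, `|c x| <= M) ->
      exists2 f : mor L a,
        `|f| <= M /\ (forall x w, f ∘ bapply (lam x) w = bapply (c x) w) &
        forall g : mor L a, (forall x w, g ∘ bapply (lam x) w = bapply (c x) w) ->
          g = f].

(** Both maps factor the one cocone obtained by composing f with [lam]. *)
Lemma po_wcolim_eq (L : A) (lam : forall x, @mor K Ban (W x) (mor (X x) L))
    (a : A) (f g : mor L a) : po_wcolim lam ->
  (forall x w, f ∘ bapply (lam x) w = g ∘ bapply (lam x) w) -> f = g.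
Proof.
move=> [lamN lam1 lamU] fg.
have [||h _ hU] := lamU a (fun x => postcomp (X x) f ∘ lam x) `|f| (normr_ge0 f).
- move=> x y h w; have N := congr1 (fun k => f ∘ k) (lamN x y h w).
  exact: (etrans N (Defs.compA _ _ _)).
- move=> x; rewrite (le_trans (norm_comp _ _))// -[leRHS]mulr1 ler_pM//.
  exact: postcomp_norm.
by transitivity h; [apply: hU|symmetry; apply: hU => x w; symmetry; exact: fg].
Qed.

End Colimit.

Hypotheses (le_xx : reflexive le) (le_tr : transitive le).

Let D := free_cat K le_xx le_tr.

(** Arrows of the free category are multiples of basis arrows, so by linearity the cocone identity
    need only be checked on the latter. The functor F is general because the lemma is applied both
    to the free extension of X and to its composite with G. *)
Lemma free_wcocone (C : ban_cat K) (W : pofunctor le (opcat Ban))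
    (F : bfunctor D C) (pm : forall x y, le x y -> mor (F x) (F y)) (a : C)
    (c : forall x, @mor K Ban (W x) (mor (F x) a)) :
    (forall x y (h : le x y) (f : @mor K D x y),
       bf_map F f = indic_coef f *: pm x y h) ->
  @is_wcocone K D (free_weight le_xx le_tr W) C F a c <->
  forall x y (h : le x y) (w : W y),
    bapply (c x) (bapply (po_map W h : @mor K Ban (W y) (W x)) w) =
    bapply (c y) w ∘ pm x y h.
Proof.
move=> FE.
have WE x y (f : @mor K D x y) (w : W y) :
    bapply (@bf_map K (opcat D) Ban (free_weight le_xx le_tr W) y x f) w =
    indic_coef f *: bapply (po_map0 W x y : @mor K Ban (W y) (W x)) w.
  exact: (app_Zl (indic_coef f) (po_map0 W x y : @mor K Ban (W y) (W x))).
split=> cN x y.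
  move=> h w; have := cN x y (indic_one K (le x y)) w.
  have h1 : (le x y)%:R = 1 :> K by rewrite (h : le x y = true).
  by rewrite WE (FE _ _ h) indic_coef_one h1 !scale1r (po_map0E W h).
move=> f w; rewrite WE app_Z.
have [xy|xy] := pselect (le x y).
  by rewrite (FE _ _ xy) comp_Zr (po_map0E W xy) cN.
rewrite (indic_coefN f)// scale0r (indic_coefE f) (indic_coefN f)// scale0r.
by rewrite /bf_map [bapply _ 0]bapp0 comp0r.
Qed.

(** Colimits over the preorder are enriched weighted colimits over its free Banach category, which G
    preserves. *)
Lemma cocontinuous_po_wcolim (A B : ban_cat K) (G : bfunctor A B)
    (X : pofunctor le A) (W : pofunctor le (opcat Ban)) (L : A)
    (lam : forall x, @mor K Ban (W x) (mor (X x) L)) :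
  cocontinuous G -> po_wcolim lam ->
  @po_wcolim B (pf_compose G X) W (G L) (fun x => bf_hom G (X x) L ∘ lam x).
Proof.
move=> Gc [lamN lam1 lamU].
pose F : bfunctor D A := free_functor le_xx le_tr X.
have FE x y (h : le x y) (f : @mor K D x y) : bf_map F f = indic_coef f *: po_map X h.
  by rewrite -(po_map0E X h).
have GFE x y (h : le x y) (f : @mor K D x y) :
    bf_map (bf_compose G F) f = indic_coef f *: po_map (pf_compose G X) h.
  by change (bf_map G (bf_map F f) = indic_coef f *: bf_map G (po_map X h));
     rewrite FE /bf_map app_Z.
have lamC : is_wcolim (F := F) (W := free_weight le_xx le_tr W) lam.
  split=> //; first exact/(free_wcocone _ FE).
  by move=> a c M M0 /(free_wcocone _ FE); exact: lamU.
have [N n1 U] := Gc _ _ _ _ _ lamC.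
split=> //; first exact/(free_wcocone _ GFE).
by move=> a c M M0 /(free_wcocone _ GFE); exact: U.
Qed.

End OrderColimits.

(** * Representable sheaves *)

Section Yoneda.
Variables (K : scalar_field) (d : Order.disp_t) (Ω : ctbDistrLatticeType d).
Local Notation Ban := (Ban K).
Local Notation leΩ := (@leΩ d Ω).
Local Notation geΩ := (@geΩ d Ω).
Local Notation PShv := (PShv K Ω).
Local Notation Shv := (Shv K Ω).

Lemma indic_map_coef (a b : bool) (x : indic K a) : (a -> b) ->
  indic_coef (bapply (indic_map K a b) x) = indic_coef x.
Proof. by case: a b x => [] [] x // /(_ isT). Qed.

Lemma indic_map_one (a b : bool) : a -> b ->
  bapply (indic_map K a b) (indic_one K a) = indic_one K b.
Proof. by case: a b => [] []. Qed.

Section Presheaf.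
Variables (X : PShv) (F : Ω) (z : X F).

(** The component at G of the map from Y(F) to X that the Yoneda lemma assigns to z. *)
Definition yon_elt G (x : indic K (G <= F)%O) : X G :=
  indic_coef x *: bapply (po_map0 X F G) z.

Lemma yon_elt_linear G : linear (@yon_elt G).
Proof. by move=> k x y; rewrite /yon_elt indic_coef_linear scalerDl scalerA. Qed.

Lemma yon_elt_bound G x : `|@yon_elt G x| <= `|z| * `|x|.
Proof.
rewrite normrZ mulrC ler_pM ?indic_coef_norm//.
by rewrite (le_trans (app_norm _ _))// ler_piMl ?po_map0_norm.
Qed.

Definition yon_elt_at G : @mor K Ban (yon K F G) (X G) :=
  mk_blin (@yon_elt_linear G) (normr_ge0 z) (@yon_elt_bound G).

Lemma yon_elt_natural : @is_natural K Ω geΩ Ban (yon K F) X yon_elt_at.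
Proof.
move=> G H h; apply: app_eq => x; rewrite !app_comp.
change (bapply (po_map X h) (yon_elt x) =
  yon_elt (bapply (indic_map K (G <= F)%O (H <= F)%O) x)).
rewrite /yon_elt app_Z indic_map_coef; last exact: (le_trans h).
have [GF|GF] := pselect (G <= F)%O; last by rewrite (indic_coefN x)// !scale0r.
have HF : geΩ F H := le_trans h GF.
by rewrite (po_map0E X (GF : geΩ F G)) (po_map0E X HF) (po_comp X (GF : geΩ F G) h HF).
Qed.

Lemma yon_elt_at_norm G : `|yon_elt_at G| <= `|z|.
Proof. by apply: blin_norm_le => // x; exact: yon_elt_bound. Qed.

Definition yon_ext : mor (yon K F : PShv) X :=
  mk_nat yon_elt_natural (normr_ge0 z) yon_elt_at_norm.

Lemma yon_ext_norm : `|yon_ext| <= `|z|.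
Proof. by apply: nat_norm_le => // G; exact: yon_elt_at_norm. Qed.

Lemma yon_extE : bapply (nat_at yon_ext F) (indic_one K (F <= F)%O) = z.
Proof.
change (yon_elt (indic_one K (F <= F)%O) = z).
by rewrite /yon_elt indic_coef_one lexx scale1r (po_map0E X (lexx F : geΩ F F)) po_id.
Qed.

End Presheaf.

(** When G <= F the basis vector over G is the restriction of the one over F; otherwise Y(F)(G) is
    zero. *)
Lemma yon_eq (X : PShv) F (f g : mor (yon K F : PShv) X) :
  bapply (nat_at f F) (indic_one K (F <= F)%O) =
  bapply (nat_at g F) (indic_one K (F <= F)%O) -> f = g.
Proof.
move=> fg; apply: nat_eq => G; apply: app_eq => x.
have [GF|GF] := pselect (G <= F)%O; last first.
  by rewrite (indic_coefE x) (indic_coefN x)// scale0r [LHS]bapp0 [RHS]bapp0.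
rewrite (indic_coefE x) !app_Z; congr (_ *: _).
rewrite -(indic_map_one (lexx F) GF) -!app_comp.
have fN := nat_natural f (GF : geΩ F G); have gN := nat_natural g (GF : geΩ F G).
rewrite -[X in bapply X _]fN -[X in _ = bapply X _]gN.
by rewrite !app_comp fg.
Qed.

Variable r : reflection (@is_sheaf K d Ω).

Lemma reflection_ext (a : PShv) (b : Shv) (f : mor a (sval b)) :
  exists2 g : @mor K PShv (sval (r a)) (sval b), `|g| <= `|f| & g ∘ rf_unit r a = f.
Proof.
have [c cE [c' [_ cK _ c'1]]] := rf_adjoint r a b.
exists (bapply c' f); first exact: (app_norm1 _ c'1).
by rewrite -cE -app_comp cK.
Qed.

Lemma reflection_eq (a : PShv) (b : Shv) (f g : @mor K PShv (sval (r a)) (sval b)) :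
  f ∘ rf_unit r a = g ∘ rf_unit r a -> f = g.
Proof.
have [c cE [c' [c'K _ _ _]]] := rf_adjoint r a b.
move=> fg; rewrite -[f](app_idm (X := mor (r a) b)) -[g](app_idm (X := mor (r a) b)).
by rewrite -c'K !app_comp !cE fg.
Qed.

(** The unit corresponds to the identity under the adjunction, which is a contraction. *)
Lemma reflection_unit_norm (a : PShv) : `|rf_unit r a| <= 1.
Proof.
have [c cE [c' [_ _ c1 _]]] := rf_adjoint r a (r a).
rewrite -[rf_unit r a]comp1f.
have -> : idm (sval (r a)) ∘ rf_unit r a = bapply c (idm (r a)) by rewrite cE.
by rewrite (le_trans (app_norm1 _ c1))// norm_idm.
Qed.

(** For F = E this is the universal element of chi(E); for F <= E it is the restriction of that
    element, and otherwise it is 0. *)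
Definition chi_elt (E F : Ω) : sval (chi r E) F :=
  bapply (nat_at (rf_unit r (yon K E)) F) (indic_one K (F <= E)%O).

Lemma chi_elt_norm E F : `|chi_elt E F| <= 1.
Proof.
rewrite (le_trans (app_norm _ _))// mulr_ile1 ?indic_one_norm//.
exact: (le_trans (nat_norm _ _) (reflection_unit_norm _)).
Qed.

Lemma chi_elt_restr E F G (h : geΩ F G) : (F <= E)%O ->
  bapply (po_map (sval (chi r E)) h) (chi_elt E F) = chi_elt E G.
Proof.
move=> FE; rewrite -app_comp.
have N := nat_natural (rf_unit r (yon K E)) h.
rewrite [X in bapply X _]N app_comp; congr bapply.
by apply: indic_map_one => //; exact: le_trans FE.
Qed.

Lemma chi_elt_map E E' F (h : leΩ E E') : (F <= E)%O ->
  bapply (nat_at (po_map (chi r) h : @mor K PShv _ _) F) (chi_elt E F) = chi_elt E' F.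
Proof.
move=> FE; rewrite -app_comp.
have N := congr1 (fun k => nat_at k F) (rf_natural r (po_map (yoneda K Ω) h)).
rewrite -[X in bapply X _]N app_comp; congr bapply.
by apply: indic_map_one => //; exact: (le_trans FE h).
Qed.

Section Evaluation.
Variables (ze : Shv) (F : Ω).

Definition chi_ev (g : mor (chi r F) ze) : sval ze F :=
  bapply (nat_at (g : @mor K PShv _ _) F) (chi_elt F F).

Lemma chi_ev_linear : linear chi_ev.
Proof. by move=> k f g; rewrite /chi_ev [nat_at _ _]nat_lin [LHS]blin_lin. Qed.

Lemma chi_ev_norm g : `|chi_ev g| <= 1 * `|g|.
Proof.
rewrite (le_trans (app_norm _ _))// mulrC ler_pM ?chi_elt_norm//.
exact: (@nat_norm K _ _ Ban _ _ g).
Qed.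

Definition chi_evm : @mor K Ban (mor (chi r F) ze) (sval ze F) :=
  mk_blin chi_ev_linear ler01 chi_ev_norm.

Lemma chi_ev_eq f g : chi_ev f = chi_ev g -> f = g.
Proof. by move=> fg; apply: reflection_eq; apply: yon_eq. Qed.

(** The Yoneda lemma for sheaves: an element z of ze(F) extends to Y(F), and then along the
    reflection to chi(F), neither extension exceeding the norm of z. *)
Lemma chi_evm_iso : isometric_iso chi_evm.
Proof.
apply: ban_iso; first by apply: blin_norm_le => // g; exact: chi_ev_norm.
  exact: chi_ev_eq.
move=> z; have [g gn gE] := @reflection_ext (yon K F) ze (yon_ext z).
exists g; last exact: (le_trans gn (yon_ext_norm z)).
rewrite -[RHS](yon_extE z).
exact: (congr1 (fun k : mor (yon K F : PShv) (sval ze) =>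
  bapply (nat_at k F) (indic_one K (F <= F)%O)) gE).
Qed.

Definition yo : @mor K Ban (sval ze F) (mor (chi r F) ze) := sval (cid chi_evm_iso).

Lemma yoE z : chi_ev (bapply yo z) = z.
Proof.
rewrite /yo; case: cid => g /= [_ gK _ _].
exact: (congr1 (fun k => bapply k z) gK).
Qed.

Lemma yo_norm : `|yo| <= 1.
Proof. by rewrite /yo; case: cid => g /= []. Qed.

End Evaluation.

Lemma chi_ev_map (ze : Shv) F G (h : leΩ G F) (g : mor (chi r F) ze) :
  chi_ev (g ∘ po_map (chi r) h) = bapply (po_map (sval ze) (h : geΩ F G)) (chi_ev g).
Proof.
rewrite /chi_ev -[RHS]app_comp (nat_natural (g : @mor K PShv _ _) (h : geΩ F G)).
rewrite [RHS]app_comp chi_elt_restr//.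
by rewrite -(chi_elt_map h (lexx G)).
Qed.

Lemma yo_restr (ze : Shv) F G (h : leΩ G F) z :
  bapply (yo ze G) (bapply (po_map (sval ze) (h : geΩ F G)) z) =
  bapply (yo ze F) z ∘ po_map (chi r) h.
Proof. by apply: chi_ev_eq; rewrite yoE chi_ev_map yoE. Qed.

Lemma yo_comp (ze ze' : Shv) (k : mor ze ze') F z :
  k ∘ bapply (yo ze F) z =
  bapply (yo ze' F) (bapply (nat_at (k : @mor K PShv _ _) F) z).
Proof. by apply: chi_ev_eq; rewrite yoE -[in RHS](yoE z). Qed.

Lemma yo_chi_elt E : bapply (yo (chi r E) E) (chi_elt E E) = idm (chi r E).
Proof. by apply: chi_ev_eq; rewrite yoE. Qed.

(** Density of the chi(F): by Yoneda a cocone with vertex ze is a natural family of maps from xi(F)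
    to ze(F), that is, a map from xi to ze. *)
Lemma yo_wcolim (xi : Shv) :
  @po_wcolim K Ω leΩ Shv (chi r) (op_pofun (sval xi)) xi (yo xi).
Proof.
split=> [F G h z|F|ze c M M0 cN cM]; first exact: (yo_restr h).
  exact: yo_norm.
pose f F : @mor K Ban (sval xi F) (sval ze F) := chi_evm ze F ∘ c F.
have fN : @is_natural K Ω geΩ Ban (sval xi) (sval ze) f.
  move=> F G h; apply: app_eq => x.
  change (bapply (po_map (sval ze) h) (chi_ev (bapply (c F) x)) =
    chi_ev (bapply (c G) (bapply (po_map (sval xi) h) x))).
  by rewrite (cN G F h) chi_ev_map.
have fM F : `|f F| <= M.
  rewrite (le_trans (norm_comp _ _))// -[M]mul1r ler_pM//; last exact: cM.
  by apply: blin_norm_le => // g; exact: chi_ev_norm.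
exists (mk_nat fN M0 fM).
  split=> [|F x]; first exact: nat_norm_le.
  rewrite yo_comp; apply: chi_ev_eq; rewrite yoE.
  by [].
move=> g gc; apply: (@nat_eq K Ω geΩ Ban) => F; apply: app_eq => x.
by have := congr1 (@chi_ev _ _) (gc F x); rewrite yo_comp yoE.
Qed.

End Yoneda.

(** * The internal hom of presheaves *)

Section InternalHom.
Variables (K : scalar_field) (d : Order.disp_t) (Ω : ctbDistrLatticeType d).
Variable T : projective_tensor K.
Local Notation Ban := (Ban K).
Local Notation leΩ := (@leΩ d Ω).
Local Notation geΩ := (@geΩ d Ω).
Local Notation PShv := (PShv K Ω).
Local Notation Shv := (Shv K Ω).

(* The opposites turn the hom presheaf, stated for covariant functors, into the
   presheaf E |-> Nat(xi|_E, ze|_E) of maps of presheaves. *)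
Definition ihom (xi ze : PShv) : PShv := hom_presheaf (op_pofun ze) (op_pofun xi).

Definition ihom_app (xi ze : PShv) E (s : ihom xi ze E) (F : downset E) :
    @mor K Ban (xi (sval F)) (ze (sval F)) :=
  @nat_at K _ _ (opcat Ban) (restr E (op_pofun ze)) (restr E (op_pofun xi)) s F.

Lemma ihom_app_lin (xi ze : PShv) E k (s t : ihom xi ze E) F :
  ihom_app (k *: s + t) F = k *: ihom_app s F + ihom_app t F.
Proof. exact: (@nat_lin K _ _ (opcat Ban) _ _ k s t F). Qed.

Lemma ihom_app_norm (xi ze : PShv) E (s : ihom xi ze E) F : `|ihom_app s F| <= `|s|.
Proof. exact: (@nat_norm K _ _ (opcat Ban) _ _ s F). Qed.

Lemma ihom_app_natural (xi ze : PShv) E (s : ihom xi ze E) (F G : downset E)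
    (h : geΩ (sval F) (sval G)) x :
  bapply (po_map ze h) (bapply (ihom_app s F) x) =
  bapply (ihom_app s G) (bapply (po_map xi h) x).
Proof.
have N := @nat_natural K _ _ (opcat Ban) _ _ s G F (h : le_downset G F).
exact: (congr1 (fun k : @mor K Ban (xi (sval F)) (ze (sval G)) => bapply k x) (esym N)).
Qed.

Lemma ihom_eq (xi ze : PShv) E (s t : ihom xi ze E) :
  (forall F x, bapply (ihom_app s F) x = bapply (ihom_app t F) x) -> s = t.
Proof.
move=> st; apply: (@nat_eq K _ _ (opcat Ban)) => F.
by apply: (@app_eq K (xi (sval F)) (ze (sval F))); exact: st.
Qed.

Section MkHom.
Variables (xi ze : PShv) (E : Ω).
Variables (s : forall F : downset E, @mor K Ban (xi (sval F)) (ze (sval F))) (M : K).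
Hypothesis sN : forall (F G : downset E) (h : geΩ (sval F) (sval G)) x,
  bapply (po_map ze h) (bapply (s F) x) = bapply (s G) (bapply (po_map xi h) x).
Hypotheses (M0 : 0 <= M) (sM : forall F, `|s F| <= M).

Lemma mk_ihom_natural : @is_natural K _ (@le_downset d Ω E) (opcat Ban)
  (restr E (op_pofun ze)) (restr E (op_pofun xi)) s.
Proof.
move=> G F h; apply: (@app_eq K (xi (sval F)) (ze (sval G))) => x.
by symmetry; exact: (sN (h : geΩ (sval F) (sval G))).
Qed.

Definition mk_ihom : ihom xi ze E :=
  @mk_nat K _ _ (opcat Ban) _ _ _ mk_ihom_natural M M0 sM.

Lemma mk_ihom_norm : `|mk_ihom| <= M.
Proof. exact: (@nat_norm_le K _ _ (opcat Ban)). Qed.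

Lemma mk_ihomE F : ihom_app mk_ihom F = s F.
Proof. by []. Qed.

End MkHom.

Lemma ihom_restr (xi ze : PShv) E E' (h : geΩ E E') (s : ihom xi ze E) (F : downset E') :
  ihom_app (bapply (po_map (ihom xi ze) h) s) F = ihom_app s (downset_incl h F).
Proof. by []. Qed.

(** * Currying for the pointwise tensor product *)

Section Curry.
Variables (sg xi ze : PShv) (b : mor (ptensor T sg xi) ze).

Definition curry_fun E (s : sg E) (F : downset E) (x : xi (sval F)) : ze (sval F) :=
  bapply (nat_at b (sval F)) (ptens T (bapply (po_map sg (svalP F : geΩ E _)) s) x).

Lemma curry_fun_linear E s F : linear (@curry_fun E s F).
Proof. by move=> k x y; rewrite /curry_fun (pure_bilinear T _ _).2 app_linear. Qed.

Lemma curry_fun_bound E s F x : `|@curry_fun E s F x| <= (`|b| * `|s|) * `|x|.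
Proof.
rewrite (le_trans (app_norm _ _))// -mulrA ler_pM ?nat_norm//.
rewrite (le_trans (pure_norm _ _ _))// ler_pM//.
by rewrite app_norm1 ?po_contr.
Qed.

Lemma curry_fun_natural E s (F G : downset E) (h : geΩ (sval F) (sval G)) x :
  bapply (po_map ze h) (@curry_fun E s F x) =
  @curry_fun E s G (bapply (po_map xi h) x).
Proof.
rewrite /curry_fun -app_comp (nat_natural b h) app_comp; congr bapply.
rewrite [LHS]pt_mapE; congr (ptens T _ _).
by rewrite -app_comp -(po_comp sg _ _ (svalP G : geΩ E _)).
Qed.

Definition curry_map E s (F : downset E) : @mor K Ban (xi (sval F)) (ze (sval F)) :=
  mk_blin (@curry_fun_linear E s F) (mulr_ge0 (normr_ge0 b) (normr_ge0 s))
    (@curry_fun_bound E s F).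

Lemma curry_map_norm E s (F : downset E) : `|curry_map s F| <= `|b| * `|s|.
Proof. by apply: blin_norm_le; [rewrite mulr_ge0|exact: curry_fun_bound]. Qed.

Definition curry_elt E (s : sg E) : ihom xi ze E :=
  mk_ihom (s := curry_map s) (@curry_fun_natural E s)
    (mulr_ge0 (normr_ge0 b) (normr_ge0 s)) (curry_map_norm s).

Lemma curry_elt_linear E : linear (@curry_elt E).
Proof.
move=> k s t; apply: ihom_eq => F x.
rewrite ihom_app_lin [RHS]blin_lin.
change (curry_fun (k *: s + t) x = k *: curry_fun s x + curry_fun t x).
by rewrite /curry_fun app_linear (pure_bilinear T _ _).1 app_linear.
Qed.

Lemma curry_elt_bound E s : `|@curry_elt E s| <= `|b| * `|s|.
Proof. exact: mk_ihom_norm. Qed.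

Definition curry_at E : @mor K Ban (sg E) (ihom xi ze E) :=
  mk_blin (@curry_elt_linear E) (normr_ge0 b) (@curry_elt_bound E).

Lemma curry_natural : @is_natural K Ω geΩ Ban sg (ihom xi ze) curry_at.
Proof.
move=> E E' h; apply: app_eq => s; apply: ihom_eq => F x.
rewrite ihom_restr.
change (curry_fun s (F := downset_incl h F) x =
  curry_fun (bapply (po_map sg h) s) x).
by rewrite /curry_fun -app_comp -(po_comp sg _ _ (svalP (downset_incl h F) : geΩ E _)).
Qed.

Lemma curry_at_norm E : `|curry_at E| <= `|b|.
Proof. by apply: blin_norm_le => // s; exact: curry_elt_bound. Qed.

Definition curry : mor sg (ihom xi ze) :=
  mk_nat curry_natural (normr_ge0 b) curry_at_norm.

Lemma curryE E s (F : downset E) x :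
  bapply (ihom_app (bapply (nat_at curry E) s) F) x =
  bapply (nat_at b (sval F)) (ptens T (bapply (po_map sg (svalP F : geΩ E _)) s) x).
Proof. by []. Qed.

End Curry.

Definition downset_top (E : Ω) : downset E := exist _ E (lexx E).

(** Evaluating sections over E at the top of the downset of E is bilinear, hence factors through the
    tensor product. Naturality of [th] makes the top component over F <= E agree with the component
    at F of the section over E. *)
Lemma uncurry_ex (sg xi ze : PShv) (th : mor sg (ihom xi ze)) :
  exists2 b : mor (ptensor T sg xi) ze, `|b| <= `|th| &
    forall E s x, bapply (nat_at b E) (ptens T s x) =
      bapply (ihom_app (bapply (nat_at th E) s) (downset_top E)) x.
Proof.
pose f E (s : sg E) (x : xi E) : ze E :=
  bapply (ihom_app (bapply (nat_at th E) s) (downset_top E)) x.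
have fB E : bilinear_map (@f E).
  split=> [x|s] k u v; rewrite /f; last exact: app_linear.
  by rewrite app_linear ihom_app_lin [LHS]blin_lin.
have fM E s x : `|@f E s x| <= `|th| * (`|s| * `|x|).
  rewrite (le_trans (app_norm _ _))// mulrA ler_wpM2r//.
  rewrite (le_trans (ihom_app_norm _ _))// (le_trans (app_norm _ _))//.
  by rewrite ler_wpM2r ?nat_norm.
pose g E := cid2 (pt_univ T (normr_ge0 th) (fB E) (fM E)).
have gE E s x : bapply (s2val (g E)) (ptens T s x) = f E s x.
  by rewrite /g; case: cid2 => ? _ /=.
have gM E : `|s2val (g E)| <= `|th| by rewrite /g; case: cid2.
have gN : @is_natural K Ω geΩ Ban (ptensor T sg xi) ze (fun E => s2val (g E)).
  move=> E F h; apply: (pt_ext (p := T)) => s x.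
  rewrite !app_comp gE [X in _ = bapply _ X]pt_mapE gE.
  rewrite /f (@ihom_app_natural _ _ _ _ (downset_top E) (exist _ F h : downset E)).
  have N : bapply (po_map (ihom xi ze) h) (bapply (nat_at th E) s) =
      bapply (nat_at th F) (bapply (po_map sg h) s).
    by rewrite -!app_comp (nat_natural th h).
  rewrite -N ihom_restr.
  by rewrite /downset_incl /= (bool_irrelevance (le_trans _ _) h).
exists (mk_nat gN (normr_ge0 th) gM) => //.
exact: nat_norm_le.
Qed.

End InternalHom.

(** * Tensoring with a representable sheaf *)

Section TensorChi.
Variables (K : scalar_field) (d : Order.disp_t) (Ω : ctbDistrLatticeType d).
Variables (T : projective_tensor K) (r : reflection (@is_sheaf K d Ω)).
Local Notation Ban := (Ban K).
Local Notation leΩ := (@leΩ d Ω).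
Local Notation geΩ := (@geΩ d Ω).
Local Notation PShv := (PShv K Ω).
Local Notation Shv := (Shv K Ω).

Lemma ptens_bound (X Y : Ban) (x : X) (y : Y) : `|ptens T x y| <= `|x| * `|y|.
Proof. exact: pure_norm. Qed.

Definition ptens_right (X Y : Ban) (x : X) : @mor K Ban Y (T X Y) :=
  mk_blin ((pure_bilinear T X Y).2 x) (normr_ge0 x) (@ptens_bound X Y x).

Lemma ptens_right_norm (X Y : Ban) (x : X) : `|ptens_right Y x| <= `|x|.
Proof. by apply: blin_norm_le => // y; exact: ptens_bound. Qed.

(** Sends x to the image under the sheafification unit of the pure tensor of [chi_elt r E F] with
    x. *)
Definition tens_elt (xi : Shv) (E F : Ω) :
    @mor K Ban (sval xi F) (sval (stensor T r (chi r E) xi) F) :=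
  nat_at (rf_unit r (ptensor T (sval (chi r E)) (sval xi))) F ∘
    ptens_right (sval xi F) (chi_elt r E F).

Lemma tens_elt_norm xi E F : `|tens_elt xi E F| <= 1.
Proof.
apply: norm_comp_le1; first exact: (le_trans (nat_norm _ _) (reflection_unit_norm _ _)).
exact: (le_trans (ptens_right_norm _ _) (chi_elt_norm _ _ _)).
Qed.

Lemma tens_elt_restr (xi : Shv) E F G (h : geΩ F G) x : (F <= E)%O ->
  bapply (po_map (sval (stensor T r (chi r E) xi)) h) (bapply (tens_elt xi E F) x) =
  bapply (tens_elt xi E G) (bapply (po_map (sval xi) h) x).
Proof.
move=> FE; rewrite /tens_elt !app_comp.
set u := rf_unit r _.
rewrite -[LHS]app_comp (nat_natural u h) app_comp; congr bapply.
by rewrite [LHS]pt_mapE chi_elt_restr.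
Qed.

Lemma tens_elt_map (xi xi' : Shv) (al : mor xi xi') E E' F (h : leΩ E E') x :
    (F <= E)%O ->
  bapply (nat_at (stensor_map T r (po_map (chi r) h) al : @mor K PShv _ _) F)
    (bapply (tens_elt xi E F) x) =
  bapply (tens_elt xi' E' F) (bapply (nat_at (al : @mor K PShv _ _) F) x).
Proof.
move=> FE; rewrite /tens_elt !app_comp /stensor_map.
set p := ptensor_map T _ _.
have N := congr1 (fun k => nat_at k F) (rf_natural r p).
rewrite -[LHS]app_comp -[X in bapply X _]N app_comp; congr bapply.
by rewrite [LHS]pt_mapE chi_elt_map.
Qed.

Section Universal.
Variables (xi ze : Shv) (E : Ω).
Let L := stensor T r (chi r E) xi.

(** In the opposite category ze becomes the source of the transformations, so its gluing property is
    the one required. *)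
Lemma ihom_sheaf : is_sheaf (ihom (sval xi) (sval ze)).
Proof. exact: hom_presheaf_sheaf (sheaf_glues (svalP ze)). Qed.

Let H : Shv := exist _ (ihom (sval xi) (sval ze)) ihom_sheaf.

(** Since the internal hom is a sheaf, Yoneda turns s into a map from chi(E) to it; this map is
    uncurried and then extended along the sheafification unit. No step increases the norm. *)
Lemma stensor_chi_ext (s : ihom (sval xi) (sval ze) E) :
  exists2 k : mor L ze, `|k| <= `|s| &
    forall (F : downset E) x, bapply (nat_at (k : @mor K PShv _ _) (sval F))
      (bapply (tens_elt xi E (sval F)) x) = bapply (ihom_app s F) x.
Proof.
pose th : mor (chi r E) H := bapply (yo r H E) s.
have [b bM bE] := uncurry_ex T (th : @mor K PShv _ (ihom (sval xi) (sval ze))).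
have [k kM kE] := @reflection_ext _ _ _ r _ ze b.
exists k.
  rewrite (le_trans kM)// (le_trans bM)//; exact: (app_norm1 _ (yo_norm r H E)).
move=> F x; rewrite /tens_elt app_comp -[LHS]app_comp.
have kF := congr1 (fun k => nat_at k (sval F)) kE.
rewrite [X in bapply X _ = _]kF [LHS]bE.
have thE : chi_ev th = s by exact: (yoE r (ze := H)).
(* The element of chi(E) over F is restricted from the universal element over E, which [th] sends to
   s; so [th] sends it to the restriction of s. *)
rewrite -(chi_elt_restr r (svalP F : geΩ E (sval F)) (lexx E)).
have N : bapply (po_map (ihom (sval xi) (sval ze)) (svalP F : geΩ E _)) s =
    bapply (nat_at (th : @mor K PShv _ (ihom (sval xi) (sval ze))) (sval F))
      (bapply (po_map (sval (chi r E)) (svalP F : geΩ E _)) (chi_elt r E E)).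
  rewrite -{1}thE /chi_ev -!app_comp.
  by rewrite (nat_natural (th : @mor K PShv _ (ihom (sval xi) (sval ze)))).
rewrite -N ihom_restr; case: F {kF N} x => F FE x.
by rewrite /downset_incl /= (bool_irrelevance (le_trans _ _) FE).
Qed.

(** After currying, both sides are maps from chi(E) to the internal hom, and these agree as soon as
    they agree on the universal element. *)
Lemma stensor_chi_eq (k k' : mor L ze) :
  (forall (F : downset E) x,
     bapply (nat_at (k : @mor K PShv _ _) (sval F)) (bapply (tens_elt xi E (sval F)) x) =
     bapply (nat_at (k' : @mor K PShv _ _) (sval F)) (bapply (tens_elt xi E (sval F)) x)) ->
  k = k'.
Proof.
move=> kk'; pose u := rf_unit r (ptensor T (sval (chi r E)) (sval xi)).
pose b := (k : @mor K PShv _ _) ∘ u; pose b' := (k' : @mor K PShv _ _) ∘ u.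
suff bb' : b = b' by exact: (@reflection_eq _ _ _ r _ ze k k' bb').
have cc' : (curry b : mor (chi r E) H) = curry b'.
  apply: chi_ev_eq; apply: ihom_eq => F x; rewrite /chi_ev !curryE.
  rewrite (chi_elt_restr r (svalP F : geΩ E (sval F)) (lexx E)).
  exact: kk'.
apply: nat_eq => F; apply: (pt_ext (p := T)) => s x.
have := congr1 (fun c : mor _ (ihom (sval xi) (sval ze)) =>
  bapply (ihom_app (bapply (nat_at c F) s) (downset_top F)) x) cc'.
by cbv beta; rewrite !curryE po_id.
Qed.

End Universal.

Definition tens_inj (xi : Shv) E (F : Ω) :
    @mor K Ban (sval xi F) (mor (chi r F) (stensor T r (chi r E) xi)) :=
  yo r (stensor T r (chi r E) xi) F ∘ tens_elt xi E F.

Lemma tens_inj_comp (xi ze : Shv) E F (k : mor (stensor T r (chi r E) xi) ze) x :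
  k ∘ bapply (tens_inj xi E F) x =
  bapply (yo r ze F) (bapply (nat_at (k : @mor K PShv _ _) F) (bapply (tens_elt xi E F) x)).
Proof. by rewrite app_comp yo_comp. Qed.

Lemma tens_inj_map (xi xi' : Shv) (al : mor xi xi') E E' F (h : leΩ E E') x :
    (F <= E)%O ->
  stensor_map T r (po_map (chi r) h) al ∘ bapply (tens_inj xi E F) x =
  bapply (tens_inj xi' E' F) (bapply (nat_at (al : @mor K PShv _ _) F) x).
Proof. by move=> FE; rewrite tens_inj_comp tens_elt_map. Qed.

Lemma tens_inj_restr (xi : Shv) E F G (h : leΩ G F) x : (F <= E)%O ->
  bapply (tens_inj xi E G) (bapply (po_map (sval xi) (h : geΩ F G)) x) =
  bapply (tens_inj xi E F) x ∘ po_map (chi r) h.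
Proof.
move=> FE; apply: etrans (yo_restr r h _).
by rewrite tens_elt_restr.
Qed.

(** By Yoneda a cocone with vertex ze is a section over E of the internal hom, to which
    [stensor_chi_ext] and [stensor_chi_eq] apply. *)
Lemma tens_wcolim (xi : Shv) E :
  @po_wcolim K _ (@le_downset d Ω E) Shv (restr E (chi r))
    (restr E (op_pofun (sval xi))) (stensor T r (chi r E) xi)
    (fun F => tens_inj xi E (sval F)).
Proof.
split=> [F G h x|F|ze c M M0 cN cM].
- exact: (tens_inj_restr (h : leΩ (sval F) (sval G)) x (svalP G)).
- exact: (norm_comp_le1 (yo_norm _ _ _) (tens_elt_norm _ _ _)).
pose f (F : downset E) : @mor K Ban (sval xi (sval F)) (sval ze (sval F)) :=
  chi_evm r ze (sval F) ∘ c F.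
have fN (F G : downset E) (h : geΩ (sval F) (sval G)) x :
    bapply (po_map (sval ze) h) (bapply (f F) x) =
    bapply (f G) (bapply (po_map (sval xi) h) x).
  change (bapply (po_map (sval ze) h) (chi_ev (bapply (c F) x)) =
    chi_ev (bapply (c G) (bapply (po_map (sval xi) h) x))).
  by rewrite (cN G F h) -chi_ev_map.
have fM F : `|f F| <= M.
  rewrite (le_trans (norm_comp _ _))// -[M]mul1r ler_pM//; last exact: cM.
  by apply: blin_norm_le => // g; exact: chi_ev_norm.
have [k kM kE] := stensor_chi_ext (mk_ihom fN M0 fM).
exists k.
  split=> [|F x]; first exact: (le_trans kM (mk_ihom_norm _ _ _)).
  by rewrite tens_inj_comp kE mk_ihomE; apply: chi_ev_eq; rewrite yoE.
move=> g gc; apply: stensor_chi_eq => F x; rewrite kE mk_ihomE.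
have := congr1 (@chi_ev _ _ _ _ _ _) (gc F x); rewrite tens_inj_comp yoE => ->.
by [].
Qed.

End TensorChi.

(** * Universal property of the indefinite integral *)

Section Integral.
Variables (K : scalar_field) (d : Order.disp_t) (Ω : ctbDistrLatticeType d).
Variables (T : projective_tensor K) (r : reflection (@is_sheaf K d Ω)).
Variable A : ban_cat K.
Local Notation Ban := (Ban K).
Local Notation leΩ := (@leΩ d Ω).
Local Notation geΩ := (@geΩ d Ω).
Local Notation PShv := (PShv K Ω).
Local Notation Shv := (Shv K Ω).
Local Notation CoShv := (CoShv Ω A).

Program Definition hom_into (mu : pofun_cat leΩ A) (b : A) : PShv :=
  @POFunctor K Ω geΩ Ban (fun F => mor (mu F) b)
    (fun F G h => precomp b (po_map mu (h : leΩ G F))) _ _ _.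
Next Obligation.
by move=> mu b F G h; exact: (le_trans (precomp_norm _ _) (po_contr _ _)).
Qed.
Next Obligation.
move=> mu b F h; apply: app_eq => f.
by change (f ∘ po_map mu (h : leΩ F F) = f); rewrite po_id compf1.
Qed.
Next Obligation.
move=> mu b E F G h h' h''; apply: app_eq => f.
change (f ∘ po_map mu (h'' : leΩ G E) =
  f ∘ po_map mu (h : leΩ F E) ∘ po_map mu (h' : leΩ G F)).
by rewrite -Defs.compA -po_comp.
Qed.

Lemma hom_into_sheaf (mu : pofun_cat leΩ A) b : glues mu -> is_sheaf (hom_into mu b).
Proof.
move=> muG; apply: sheaf_of_gluing => E n P hP.
  move=> x M M0 xM; have [g [gM gx _]] := muG E n P hP b x M M0 xM.
  by exists g => // i h; exact: gx.
move=> x y xy; apply: (glues_along_eq (muG E n P hP)) => [i h|i]; first exact: xy.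
exact: partition_le hP i.
Qed.

Section Universal.
Variables (mu : CoShv) (I : integral r mu).

Definition int_chi_inv : mor (sval mu) (pf_compose I (chi r)) :=
  sval (cid (int_chi_iso I)).

Lemma int_chiK F : nat_at int_chi_inv F ∘ nat_at (int_chi I) F = idm (I (chi r F)).
Proof.
rewrite /int_chi_inv; case: cid => g /= [gK _ _ _].
exact: (congr1 (fun k => nat_at k F) gK).
Qed.

Lemma int_chi_invK F : nat_at (int_chi I) F ∘ nat_at int_chi_inv F = idm (sval mu F).
Proof.
rewrite /int_chi_inv; case: cid => g /= [_ gK _ _].
exact: (congr1 (fun k => nat_at k F) gK).
Qed.

Lemma int_chi_norm : `|int_chi I| <= 1.
Proof. by case: (int_chi_iso I) => g []. Qed.

Lemma int_chi_inv_norm : `|int_chi_inv| <= 1.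
Proof. by rewrite /int_chi_inv; case: cid => g /= []. Qed.

(** The integral of the colimit injection [tens_inj], with its source, the integral of chi(F),
    replaced by the isomorphic mu(F). *)
Definition int_inj (xi : Shv) (E F : Ω) :
    @mor K Ban (sval xi F) (mor (sval mu F) (indefinite_integral T r I xi E)) :=
  precomp (I (stensor T r (chi r E) xi)) (nat_at int_chi_inv F : mor _ (I (chi r F)))
    ∘ (bf_hom I (chi r F) (stensor T r (chi r E) xi) ∘ tens_inj T r xi E F).

Lemma int_injE xi E F x :
  bapply (int_inj xi E F) x =
  bf_map I (bapply (tens_inj T r xi E F) x) ∘ nat_at int_chi_inv F.
Proof. by []. Qed.

Lemma int_inj_norm xi E F : `|int_inj xi E F| <= 1.
Proof.
apply: norm_comp_le1.
  rewrite (le_trans (precomp_norm _ _))//.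
  exact: (le_trans (nat_norm _ _) int_chi_inv_norm).
apply: norm_comp_le1; first exact: bf_contr.
exact: (norm_comp_le1 (yo_norm _ _ _) (tens_elt_norm _ _ _ _ _)).
Qed.

Lemma int_inj_restr (xi : Shv) E F G (h : leΩ G F) x : (F <= E)%O ->
  bapply (int_inj xi E G) (bapply (po_map (sval xi) (h : geΩ F G)) x) =
  bapply (int_inj xi E F) x ∘ po_map (sval mu) h.
Proof.
move=> FE; rewrite !int_injE tens_inj_restr// bf_mapM -!Defs.compA; congr (_ ∘ _).
exact: (nat_natural int_chi_inv h).
Qed.

Lemma int_inj_map (xi xi' : Shv) (al : mor xi xi') E E' F (h : leΩ E E') x :
    (F <= E)%O ->
  bf_map I (stensor_map T r (po_map (chi r) h) al) ∘ bapply (int_inj xi E F) x =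
  bapply (int_inj xi' E' F) (bapply (nat_at (al : @mor K PShv _ _) F) x).
Proof.
by move=> FE; rewrite !int_injE Defs.compA -bf_mapM tens_inj_map.
Qed.

Lemma int_inj_incl (xi : Shv) E E' F (h : leΩ E E') x : (F <= E)%O ->
  po_map (indefinite_integral T r I xi) h ∘ bapply (int_inj xi E F) x =
  bapply (int_inj xi E' F) x.
Proof. by move=> FE; apply: etrans (int_inj_map (idm xi) h x FE) _. Qed.

(** The integral is cocontinuous, so it preserves the colimit [tens_wcolim]; this is the existence
    half of the resulting universal property, and [int_eq] is the uniqueness half. *)
Lemma int_univ (xi : Shv) E (b : A)
    (c : forall F : downset E,
       @mor K Ban (sval xi (sval F)) (mor (sval mu (sval F)) b)) (M : K) :
  0 <= M ->
  (forall (F G : downset E) (h : geΩ (sval F) (sval G)) x,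
     bapply (c F) x ∘ po_map (sval mu) (h : leΩ (sval G) (sval F)) =
     bapply (c G) (bapply (po_map (sval xi) h) x)) ->
  (forall F, `|c F| <= M) ->
  exists2 f : mor (indefinite_integral T r I xi E) b,
    `|f| <= M &
    forall (F : downset E) x, f ∘ bapply (int_inj xi E (sval F)) x = bapply (c F) x.
Proof.
move=> M0 cN cM.
have le_xx : reflexive (@le_downset d Ω E) by move=> F; exact: lexx.
have le_tr : transitive (@le_downset d Ω E) by move=> G F H; exact: le_trans.
have [_ _ U] := cocontinuous_po_wcolim le_xx le_tr (int_cocontinuous I)
  (tens_wcolim T r xi E).
(* The preserved colimit is built from the integrals of the chi(F), so the cocone is transported
   from mu(F) along [int_chi]. *)
pose cc (F : downset E) :
    @mor K Ban (sval xi (sval F)) (mor (I (chi r (sval F))) b) :=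
  precomp b (nat_at (int_chi I) (sval F)) ∘ c F.
have [|F|f [fM fE] _] := U b cc M M0.
- move=> G F h x.
  change (bapply (c G) (bapply (po_map (sval xi) (h : geΩ (sval F) (sval G))) x) ∘
      nat_at (int_chi I) (sval G) =
    bapply (c F) x ∘ nat_at (int_chi I) (sval F) ∘
      bf_map I (po_map (chi r) (h : leΩ (sval G) (sval F)))).
  rewrite -cN -!Defs.compA; congr (_ ∘ _).
  exact: (nat_natural (int_chi I) (h : leΩ (sval G) (sval F))).
- rewrite (le_trans (norm_comp _ _))// -[M]mul1r ler_pM//; last exact: cM.
  by rewrite (le_trans (precomp_norm _ _))// (le_trans (nat_norm _ _))// int_chi_norm.
exists f => // F x; rewrite int_injE Defs.compA.
have := fE F x; rewrite app_comp => ->.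
change (bapply (c F) x ∘ nat_at (int_chi I) (sval F) ∘ nat_at int_chi_inv (sval F) =
  bapply (c F) x).
by rewrite -Defs.compA int_chi_invK compf1.
Qed.

Lemma int_eq (xi : Shv) E (b : A) (f g : mor (indefinite_integral T r I xi E) b) :
  (forall (F : downset E) x, f ∘ bapply (int_inj xi E (sval F)) x =
     g ∘ bapply (int_inj xi E (sval F)) x) -> f = g.
Proof.
move=> fg.
have le_xx : reflexive (@le_downset d Ω E) by move=> F; exact: lexx.
have le_tr : transitive (@le_downset d Ω E) by move=> G F H; exact: le_trans.
have W := cocontinuous_po_wcolim le_xx le_tr (int_cocontinuous I)
  (tens_wcolim T r xi E).
apply: (po_wcolim_eq W) => F x.
have := fg F x; rewrite !int_injE !Defs.compA => fgF.
change (f ∘ bf_map I (bapply (tens_inj T r xi E (sval F)) x) =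
  g ∘ bf_map I (bapply (tens_inj T r xi E (sval F)) x)).
by rewrite -[LHS]compf1 -[RHS]compf1 -(int_chiK (sval F)) !Defs.compA fgF.
Qed.

Definition int_elt (xi : Shv) E (b : A) (k : mor (indefinite_integral T r I xi E) b)
    (F : downset E) : @mor K Ban (sval xi (sval F)) (hom_into (sval mu) b (sval F)) :=
  postcomp (sval mu (sval F)) k ∘ int_inj xi E (sval F).

Lemma int_elt_natural (xi : Shv) E (b : A) (k : mor (indefinite_integral T r I xi E) b)
    (F G : downset E) (h : geΩ (sval F) (sval G)) x :
  bapply (po_map (hom_into (sval mu) b) h) (bapply (int_elt k F) x) =
  bapply (int_elt k G) (bapply (po_map (sval xi) h) x).
Proof.
change (k ∘ bapply (int_inj xi E (sval F)) x ∘ po_map (sval mu) (h : leΩ _ _) =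
  k ∘ bapply (int_inj xi E (sval G)) (bapply (po_map (sval xi) h) x)).
by rewrite -Defs.compA -int_inj_restr ?(svalP F).
Qed.

Lemma int_elt_norm (xi : Shv) E (b : A) (k : mor (indefinite_integral T r I xi E) b) F :
  `|int_elt k F| <= `|k|.
Proof.
rewrite (le_trans (norm_comp _ _))// -[leRHS]mulr1 ler_pM ?int_inj_norm//.
exact: postcomp_norm.
Qed.

(** By [int_univ] and [int_eq], maps to b from the integral over E are the sections over E of the
    internal hom from xi to Hom(mu(-), b). That is a sheaf because mu is a cosheaf, so gluing maps
    amounts to gluing sections. *)
Lemma indefinite_integral_cosheaf (xi : Shv) :
  is_cosheaf (indefinite_integral T r I xi).
Proof.
apply: glues_cosheaf => E n P hP b f M M0 fM.
have ZS : is_sheaf (hom_into (sval mu) b).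
  exact/hom_into_sheaf/cosheaf_glues/(svalP mu).
have HS : is_sheaf (ihom (sval xi) (hom_into (sval mu) b)) :=
  ihom_sheaf xi (exist _ _ ZS : Shv).
pose elt D (k : mor (indefinite_integral T r I xi D) b) :=
  mk_ihom (int_elt_natural k) (normr_ge0 k) (int_elt_norm k).
have eltM i : `|elt _ (f i)| <= M by exact: (le_trans (mk_ihom_norm _ _ _) (fM i)).
have [y yE yM] := sheaf_glue HS hP M0 eltM.
have [g gM gE] := @int_univ xi E b (fun F => ihom_app y F) M M0
  (fun F G h x => ihom_app_natural y h x)
  (fun F => le_trans (ihom_app_norm y F) yM).
(* Precomposition with a transition map of the indefinite integral corresponds to restriction of
   sections. *)
have elt_restr D D' (h : leΩ D D') k k' :
    k' ∘ po_map (indefinite_integral T r I xi) h = k ->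
    bapply (po_map (ihom (sval xi) (hom_into (sval mu) b)) (h : geΩ D' D)) (elt D' k') =
    elt D k.
  move=> <-; apply: ihom_eq => F x; rewrite ihom_restr !mk_ihomE.
  change (k' ∘ bapply (int_inj xi D' (sval F)) x =
    k' ∘ po_map (indefinite_integral T r I xi) h ∘ bapply (int_inj xi D (sval F)) x).
  by rewrite -Defs.compA int_inj_incl ?(svalP F).
exists g; split=> // [i h|g' g'f].
  apply: int_eq => F x; rewrite -Defs.compA int_inj_incl ?(svalP F)//.
  rewrite (gE (downset_incl h F)).
  exact: (congr1 (fun z => bapply (ihom_app z F) x) (yE i h)).
have eltE : elt E g' = y.
  by apply: (sheaf_eq HS hP) => i h; rewrite (yE i h); exact: elt_restr.
apply: int_eq => F x; rewrite (gE F) -eltE mk_ihomE.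
by [].
Qed.

(** * The isometry of the theorem, as transposition *)

Section Transpose.
Variables (xi : Shv) (nu : pofun_cat leΩ A).
Local Notation Int := (indefinite_integral T r I xi).

Section TransposeAt.
Variable f : mor Int nu.

(** Restricting x to F and injecting into the integral over F, instead of over E, gives a map to
    which f applies at F. *)
Definition transpose_fun E (x : sval xi E) (F : downset E) :
    mor (sval mu (sval F)) (nu (sval F)) :=
  nat_at f (sval F) ∘ bapply (int_inj xi (sval F) (sval F))
    (bapply (po_map (sval xi) (svalP F : geΩ E _)) x).

Lemma transpose_fun_natural E x :
  @is_natural K _ (@le_downset d Ω E) A (restr E (sval mu)) (restr E nu)
    (@transpose_fun E x).
Proof.
move=> G F h; rewrite /transpose_fun Defs.compA.
have N := nat_natural f (h : leΩ (sval G) (sval F)).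
apply: (etrans (congr1 (fun k => k ∘ _) N)).
rewrite -[LHS]Defs.compA -[RHS]Defs.compA int_inj_incl//; congr (_ ∘ _).
apply: etrans (int_inj_restr (h : leΩ (sval G) (sval F)) _ (lexx _)); congr bapply.
by rewrite -app_comp -(po_comp (sval xi) _ _ (svalP G : geΩ E _)).
Qed.

Lemma transpose_fun_norm E x F : `|@transpose_fun E x F| <= `|f| * `|x|.
Proof.
rewrite (le_trans (norm_comp _ _))// ler_pM ?nat_norm//.
rewrite (le_trans (app_norm1 _ (int_inj_norm _ _ _)))//.
exact: (app_norm1 _ (po_contr _ _)).
Qed.

Definition transpose_elt E (x : sval xi E) : hom_presheaf (sval mu) nu E :=
  mk_nat (@transpose_fun_natural E x) (mulr_ge0 (normr_ge0 f) (normr_ge0 x))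
    (@transpose_fun_norm E x).

Lemma transpose_elt_linear E : linear (@transpose_elt E).
Proof.
move=> k x y; apply: nat_eq => F; rewrite nat_lin.
change (transpose_fun (k *: x + y) F = k *: transpose_fun x F + transpose_fun y F).
by rewrite /transpose_fun !app_linear comp_linr.
Qed.

Lemma transpose_elt_bound E x : `|@transpose_elt E x| <= `|f| * `|x|.
Proof. by apply: nat_norm_le; [rewrite mulr_ge0|exact: transpose_fun_norm]. Qed.

Definition transpose_at E : @mor K Ban (sval xi E) (hom_presheaf (sval mu) nu E) :=
  mk_blin (@transpose_elt_linear E) (normr_ge0 f) (@transpose_elt_bound E).

Lemma transpose_at_natural :
  @is_natural K Ω geΩ Ban (sval xi) (hom_presheaf (sval mu) nu) transpose_at.
Proof.
move=> E E' h; apply: app_eq => x; apply: nat_eq => F.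
change (transpose_fun x (downset_incl h F) =
  transpose_fun (bapply (po_map (sval xi) h) x) F).
rewrite /transpose_fun; congr (_ ∘ bapply _ _).
by rewrite -app_comp -(po_comp (sval xi) _ _ (svalP (downset_incl h F) : geΩ E _)).
Qed.

Lemma transpose_at_norm E : `|transpose_at E| <= `|f|.
Proof. by apply: blin_norm_le => // x; exact: transpose_elt_bound. Qed.

Definition transpose : mor (sval xi) (hom_presheaf (sval mu) nu) :=
  mk_nat transpose_at_natural (normr_ge0 f) transpose_at_norm.

Lemma transpose_norm : `|transpose| <= `|f|.
Proof. by apply: nat_norm_le => // E; exact: transpose_at_norm. Qed.

End TransposeAt.

Definition hom_app E (s : hom_presheaf (sval mu) nu E) (F : downset E) :
  mor (sval mu (sval F)) (nu (sval F)) := nat_at s F.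

Lemma hom_app_natural E (s : hom_presheaf (sval mu) nu E) (F G : downset E)
    (h : leΩ (sval F) (sval G)) :
  po_map nu h ∘ hom_app s F = hom_app s G ∘ po_map (sval mu) h.
Proof. exact: (nat_natural s (h : le_downset F G)). Qed.

Lemma hom_app_linear E F : linear (fun s : hom_presheaf (sval mu) nu E => hom_app s F).
Proof. by move=> k s t; exact: (@nat_lin K _ _ A _ _ k s t F). Qed.

Lemma hom_app_bound E F (s : hom_presheaf (sval mu) nu E) : `|hom_app s F| <= 1 * `|s|.
Proof. by rewrite mul1r; exact: (nat_norm s F). Qed.

Definition hom_appm E (F : downset E) : @mor K Ban (hom_presheaf (sval mu) nu E)
    (mor (sval mu (sval F)) (nu (sval F))) :=
  mk_blin (@hom_app_linear E F) ler01 (@hom_app_bound E F).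

Lemma hom_appm_norm E (F : downset E) : `|hom_appm F| <= 1.
Proof. by apply: blin_norm_le => // s; exact: hom_app_bound. Qed.

Lemma transposeE f E (x : sval xi E) (F : downset E) :
  hom_app (bapply (nat_at (transpose f) E) x) F =
  nat_at f (sval F) ∘ bapply (int_inj xi (sval F) (sval F))
    (bapply (po_map (sval xi) (svalP F : geΩ E _)) x).
Proof. by []. Qed.

Lemma transpose_top f E (F : downset E) (x : sval xi (sval F)) :
  hom_app (bapply (nat_at (transpose f) (sval F)) x) (downset_top (sval F)) =
  nat_at f (sval F) ∘ bapply (int_inj xi (sval F) (sval F)) x.
Proof. by rewrite transposeE po_id. Qed.

Lemma transpose_linear : linear transpose.
Proof.
move=> k f g; apply: nat_eq => E; apply: app_eq => x; apply: nat_eq => F.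
transitivity (k *: transpose_fun f x F + transpose_fun g x F).
  change (transpose_fun (k *: f + g) x F = k *: transpose_fun f x F + transpose_fun g x F).
  by rewrite /transpose_fun nat_lin comp_linl.
symmetry; apply: (etrans (congr1 (fun z => hom_app (bapply z x) F)
  (@nat_lin K _ _ Ban _ _ k (transpose f) (transpose g) E))).
apply: (etrans (congr1 (fun z => hom_app z F)
  (blin_lin k (nat_at (transpose f) E) (nat_at (transpose g) E) x))).
exact: hom_app_linear.
Qed.

Lemma transpose_bound f : `|transpose f| <= 1 * `|f|.
Proof. by rewrite mul1r transpose_norm. Qed.

Definition transposem :
    @mor K Ban (mor Int nu) (mor (sval xi) (hom_presheaf (sval mu) nu)) :=
  mk_blin transpose_linear ler01 transpose_bound.

(** The injection at F into the integral over E factors through the integral over F. By naturality f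
    is thus determined by its values on the injections at F into the integral over F, which are the
    top components of the transpose. *)
Lemma transpose_inj f g : transpose f = transpose g -> f = g.
Proof.
move=> fg; apply: nat_eq => E; apply: int_eq => F x.
rewrite -(int_inj_incl (svalP F : leΩ _ E) x (lexx _)) !Defs.compA.
rewrite -(nat_natural f) -(nat_natural g) -!Defs.compA; congr (_ ∘ _).
by rewrite -!transpose_top fg.
Qed.

Lemma transpose_surj (g : mor (sval xi) (hom_presheaf (sval mu) nu)) :
  exists2 f, transpose f = g & `|f| <= `|g|.
Proof.
(* Naturality of g: all components of its values are top components over smaller elements. *)
have gN E (F : downset E) (x : sval xi E) :
    hom_app (bapply (nat_at g E) x) F =
    hom_app (bapply (nat_at g (sval F)) (bapply (po_map (sval xi) (svalP F : geΩ E _)) x))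
      (downset_top (sval F)).
  have N : bapply (po_map (hom_presheaf (sval mu) nu) (svalP F : geΩ E _))
        (bapply (nat_at g E) x) =
      bapply (nat_at g (sval F)) (bapply (po_map (sval xi) (svalP F : geΩ E _)) x).
    by rewrite -!app_comp (nat_natural g).
  rewrite -N; case: F {N} => F FE.
  change (hom_app (bapply (nat_at g E) x) (exist _ F FE) =
    hom_app (bapply (nat_at g E) x)
      (downset_incl (svalP (exist _ F FE : downset E)) (downset_top F))).
  by rewrite /downset_incl /= (bool_irrelevance (le_trans _ _) FE).
(* The top components of g, pushed forward to nu(E), form a cocone; the map it induces out of the
   integral over E is the preimage at E. *)
pose c E (F : downset E) : @mor K Ban (sval xi (sval F)) (mor (sval mu (sval F)) (nu E)) :=
  postcomp _ (po_map nu (svalP F : leΩ _ E)) ∘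
    (hom_appm (downset_top (sval F)) ∘ nat_at g (sval F)).
have cE E F x : bapply (@c E F) x = po_map nu (svalP F : leΩ _ E) ∘
    hom_app (bapply (nat_at g (sval F)) x) (downset_top (sval F)) by [].
have cN E (F G : downset E) (h : geΩ (sval F) (sval G)) x :
    bapply (c E F) x ∘ po_map (sval mu) (h : leΩ (sval G) (sval F)) =
    bapply (c E G) (bapply (po_map (sval xi) h) x).
  (* Placing G in the downset of F turns the compatibility into naturality of the single
     transformation that g assigns to x over F. *)
  pose G' : downset (sval F) := exist _ (sval G) h.
  have gG : hom_app (bapply (nat_at g (sval G)) (bapply (po_map (sval xi) h) x))
      (downset_top (sval G)) = hom_app (bapply (nat_at g (sval F)) x) G'.
    by rewrite [RHS]gN (po_map_irr (sval xi) (svalP G' : geΩ (sval F) (sval G)) h).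
  rewrite !cE gG -Defs.compA.
  rewrite -(@hom_app_natural _ _ G' (downset_top (sval F)) h).
  by rewrite Defs.compA -(po_comp nu _ _ (svalP G : leΩ _ E)).
have cM E F : `|@c E F| <= `|g|.
  rewrite -[leRHS]mul1r (le_trans (norm_comp _ _))// ler_pM//.
    exact: (le_trans (postcomp_norm _ _) (po_contr _ _)).
  rewrite -[leRHS]mul1r (le_trans (norm_comp _ _))// ler_pM ?nat_norm//.
  exact: hom_appm_norm.
pose f E := cid2 (int_univ (normr_ge0 g) (@cN E) (@cM E)).
have fE E (F : downset E) x :
    s2val (f E) ∘ bapply (int_inj xi E (sval F)) x = bapply (c E F) x.
  by rewrite /f; case: cid2 => ? _ /=.
have fM E : `|s2val (f E)| <= `|g| by rewrite /f; case: cid2.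
have fN : @is_natural K Ω leΩ A Int nu (fun E => s2val (f E)).
  move=> E' E h; apply: int_eq => F x.
  rewrite -!Defs.compA fE (int_inj_incl h) ?(svalP F)//.
  rewrite (fE E (downset_incl h F)) !cE Defs.compA; congr (_ ∘ _).
  by rewrite -(po_comp nu _ _ (svalP (downset_incl h F) : leΩ _ E)).
exists (mk_nat fN (normr_ge0 g) fM); last exact: nat_norm_le.
apply: nat_eq => E; apply: app_eq => x; apply: nat_eq => F.
apply: etrans (esym (gN E F x)).
rewrite [LHS]transposeE.
by rewrite [LHS](fE (sval F) (downset_top (sval F))) cE po_id comp1f.
Qed.

Lemma transposem_iso : isometric_iso transposem.
Proof.
apply: ban_iso; first by apply: blin_norm_le => // f; exact: transpose_bound.
  exact: transpose_inj.
exact: transpose_surj.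
Qed.

End Transpose.
End Universal.
End Integral.

(** * Naturality *)

Section Naturality.
Variables (K : scalar_field) (d : Order.disp_t) (Ω : ctbDistrLatticeType d).
Variables (T : projective_tensor K) (r : reflection (@is_sheaf K d Ω)).
Variable A : ban_cat K.
Local Notation Ban := (Ban K).
Local Notation leΩ := (@leΩ d Ω).
Local Notation geΩ := (@geΩ d Ω).
Local Notation PShv := (PShv K Ω).
Local Notation Shv := (Shv K Ω).
Local Notation CoShv := (CoShv Ω A).
Local Notation Int I xi := (indefinite_integral T r I xi).

Lemma transpose_natural_sheaf (mu : CoShv) (I : integral r mu) (nu : pofun_cat leΩ A)
    (xi xi' : Shv) (al : mor xi' xi) (f : mor (Int I xi) nu) :
  transpose (f ∘ indefinite_integral_map T r I al) =
  transpose f ∘ (al : @mor K PShv _ _).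
Proof.
apply: nat_eq => E; apply: app_eq => x; apply: nat_eq => F.
change (transpose_fun (f ∘ indefinite_integral_map T r I al) x F =
  transpose_fun f (bapply (nat_at (al : @mor K PShv _ _) E) x) F).
rewrite /transpose_fun -[LHS]Defs.compA; congr (_ ∘ _).
pose FE : geΩ E (sval F) := svalP F.
have N : bapply (po_map (sval xi) FE) (bapply (nat_at (al : @mor K PShv _ _) E) x) =
    bapply (nat_at (al : @mor K PShv _ _) (sval F)) (bapply (po_map (sval xi') FE) x).
  by rewrite -!app_comp (nat_natural (al : @mor K PShv _ _)).
(* Taken at the trivial inequality F <= F, where the transition map of chi is the identity. *)
have M := int_inj_map T I al (lexx _ : leΩ _ (sval F))
  (bapply (po_map (sval xi') FE) x) (lexx _).
rewrite (po_id (chi r)) in M.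
by apply: (etrans M); congr bapply; exact: esym N.
Qed.

Lemma transpose_natural_target (mu : CoShv) (I : integral r mu)
    (nu nu' : pofun_cat leΩ A) (xi : Shv) (be : mor nu nu') (f : mor (Int I xi) nu) :
  transpose (be ∘ f) = hom_presheaf_map (idm (sval mu)) be ∘ transpose f.
Proof.
apply: nat_eq => E; apply: app_eq => x; apply: nat_eq => F.
change (transpose_fun (be ∘ f) x F =
  nat_at be (sval F) ∘ transpose_fun f x F ∘ idm (sval mu (sval F))).
by rewrite compf1 /transpose_fun Defs.compA.
Qed.

(** * Naturality in the cosheaf of integration *)

Section Measure.
Variables (mu mu' : CoShv) (I : integral r mu) (I' : integral r mu') (ga : mor mu' mu).

Lemma int_chi_inv_map (t : bnat I' I) F : integral_map ga t ->
  t (chi r F) ∘ nat_at (int_chi_inv I') F =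
  nat_at (int_chi_inv I) F ∘ nat_at (ga : @mor K (pofun_cat leΩ A) _ _) F.
Proof.
move=> gat; rewrite -[t _]comp1f -(int_chiK I F) -(Defs.compA _ _ (t _)) gat.
by rewrite -!Defs.compA int_chi_invK compf1.
Qed.

(** Naturality of t moves the comparison from chi(E) ⊗ xi to chi(F), where t is given by ga. *)
Lemma int_inj_trans (t : bnat I' I) (xi : Shv) E F x : integral_map ga t ->
  t (stensor T r (chi r E) xi) ∘ bapply (int_inj T I' xi E F) x =
  bapply (int_inj T I xi E F) x ∘ nat_at (ga : @mor K (pofun_cat leΩ A) _ _) F.
Proof.
move=> gat; rewrite !int_injE Defs.compA -bn_natural -!Defs.compA.
by rewrite int_chi_inv_map.
Qed.

Lemma transpose_natural_measure (nu : pofun_cat leΩ A) (xi : Shv) (t : bnat I' I)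
    (f : mor (Int I xi) nu) : integral_map ga t ->
  transpose (f ∘ indefinite_integral_trans T r xi t) =
  hom_presheaf_map (ga : @mor K (pofun_cat leΩ A) _ _) (idm nu) ∘ transpose f.
Proof.
move=> gat; apply: nat_eq => E; apply: app_eq => x; apply: nat_eq => F.
change (transpose_fun (f ∘ indefinite_integral_trans T r xi t) x F =
  idm (nu (sval F)) ∘ transpose_fun f x F ∘
    nat_at (ga : @mor K (pofun_cat leΩ A) _ _) (sval F)).
rewrite comp1f /transpose_fun -[LHS]Defs.compA -[RHS]Defs.compA; congr (_ ∘ _).
exact: int_inj_trans.
Qed.

(** The functor I' preserves the presentation of each sheaf as a colimit of the chi(F), so t can be
    prescribed on the chi(F) and then extended, with the norm of ga as a uniform bound. *)
Lemma integral_map_ex : exists t : bnat I' I, integral_map ga t.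
Proof.
have W xi := cocontinuous_po_wcolim (@lexx _ Ω) (@le_trans _ Ω) (int_cocontinuous I')
  (yo_wcolim r xi).
pose G F : mor (sval mu' F) (sval mu F) := nat_at (ga : @mor K (pofun_cat leΩ A) _ _) F.
(* The value at chi(F) forced by the condition on t: ga transported along the two isomorphisms
   [int_chi]. *)
pose ta F : mor (I' (chi r F)) (I (chi r F)) :=
  nat_at (int_chi_inv I) F ∘ (G F ∘ nat_at (int_chi I') F).
have taN F G' (h : leΩ F G') : bf_map I (po_map (chi r) h) ∘ ta F =
    ta G' ∘ bf_map I' (po_map (chi r) h).
  have N1 : bf_map I (po_map (chi r) h) ∘ nat_at (int_chi_inv I) F =
      nat_at (int_chi_inv I) G' ∘ po_map (sval mu) h := nat_natural (int_chi_inv I) h.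
  have N2 : po_map (sval mu) h ∘ G F = G G' ∘ po_map (sval mu') h :=
    nat_natural (ga : @mor K (pofun_cat leΩ A) _ _) h.
  have N3 : po_map (sval mu') h ∘ nat_at (int_chi I') F =
      nat_at (int_chi I') G' ∘ bf_map I' (po_map (chi r) h) := nat_natural (int_chi I') h.
  apply: (etrans (Defs.compA _ _ _)); apply: (etrans (congr1 (fun k => k ∘ _) N1)).
  rewrite -Defs.compA; apply: (etrans _ (Defs.compA _ _ _)); congr (_ ∘ _).
  by rewrite Defs.compA N2 -Defs.compA N3 Defs.compA.
have taM F : `|ta F| <= `|ga|.
  rewrite -[leRHS]mul1r (le_trans (norm_comp _ _))// ler_pM//.
    exact: (le_trans (nat_norm _ _) (int_chi_inv_norm _)).
  rewrite -[leRHS]mulr1 (le_trans (norm_comp _ _))// ler_pM//.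
    exact: (@nat_norm K _ _ A _ _ ga).
  exact: (le_trans (nat_norm _ _) (int_chi_norm _)).
pose c (xi : Shv) F : @mor K Ban (sval xi F) (mor (I' (chi r F)) (I xi)) :=
  precomp (I xi) (ta F) ∘ (bf_hom I (chi r F) xi ∘ yo r xi F).
have cE xi F x : bapply (c xi F) x = bf_map I (bapply (yo r xi F) x) ∘ ta F by [].
have tex (xi : Shv) : exists2 t : mor (I' xi) (I xi), `|t| <= `|ga| &
    forall F x, t ∘ bf_map I' (bapply (yo r xi F) x) = bf_map I (bapply (yo r xi F) x) ∘ ta F.
  have [_ _ U] := W xi.
  have [||t [tM tE] _] := U (I xi) (c xi) `|ga| (normr_ge0 ga).
  - move=> F G' h x; rewrite !cE.
    have := yo_restr r h x => N.
    apply: (etrans (congr1 (fun k => bf_map I k ∘ ta F) N)).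
    by rewrite bf_mapM -[LHS]Defs.compA taN Defs.compA.
  - move=> F; rewrite -[leRHS]mulr1 (le_trans (norm_comp _ _))// ler_pM//.
      exact: (le_trans (precomp_norm _ _) (taM F)).
    by rewrite norm_comp_le1 ?bf_contr ?yo_norm.
  by exists t => // F x; exact: tE.
pose t xi := s2val (cid2 (tex xi)).
have tM xi : `|t xi| <= `|ga| by rewrite /t; case: cid2.
have tE xi F x : t xi ∘ bf_map I' (bapply (yo r xi F) x) =
    bf_map I (bapply (yo r xi F) x) ∘ ta F by rewrite /t; case: cid2 => ? _ /=.
(* Tested on colimit injections: f carries the injection at x to the injection at the image of x,
   where [tE] computes both sides. *)
have tN (xi ze : Shv) (f : mor xi ze) : bf_map I f ∘ t xi = t ze ∘ bf_map I' f.
  apply: (po_wcolim_eq (W xi)) => F x.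
  change (bf_map I f ∘ t xi ∘ bf_map I' (bapply (yo r xi F) x) =
    t ze ∘ bf_map I' f ∘ bf_map I' (bapply (yo r xi F) x)).
  rewrite -!Defs.compA tE -bf_mapM Defs.compA -bf_mapM.
  by rewrite !yo_comp tE.
exists (BNat tN (ex_intro _ _ tM)) => E.
change (nat_at (int_chi I) E ∘ t (chi r E) = G E ∘ nat_at (int_chi I') E).
(* The universal element of chi(E) classifies the identity, so here t is [ta E]. *)
have := tE (chi r E) E (chi_elt r E E).
rewrite yo_chi_elt /bf_map !bf_idm compf1 comp1f => ->.
apply: (etrans (Defs.compA _ _ _)).
by apply: (etrans (congr1 (fun k => k ∘ _) (int_chi_invK I E))); rewrite comp1f.
Qed.

End Measure.
End Naturality.

(** An integral is determined only up to unique isomorphism, so J fixes one for each cosheaf.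
    Naturality in μ is then expressed through transformations t of the chosen integrals that are
    induced by γ, whose existence is part of the conclusion. *)
Theorem theorem7p21 (K : scalar_field) (d : Order.disp_t)
    (Ω : ctbDistrLatticeType d) (A : banach_2space K)
    (T : projective_tensor K) (r : reflection (@is_sheaf K d Ω))
    (J : forall μ : CoShv Ω A, integral r μ) :
  exists (int_cosheaf : forall (ξ : Shv K Ω) (μ : CoShv Ω A),
            is_cosheaf (indefinite_integral T r (J μ) ξ))
         (hom_sheaf : forall μ ν : CoShv Ω A,
            is_sheaf (hom_presheaf (sval μ) (sval ν))),
  let Int (ξ : Shv K Ω) (μ : CoShv Ω A) : CoShv Ω A :=
    exist _ (indefinite_integral T r (J μ) ξ) (int_cosheaf ξ μ) in
  let Hom (μ ν : CoShv Ω A) : Shv K Ω :=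
    exist _ (hom_presheaf (sval μ) (sval ν)) (hom_sheaf μ ν) in
  exists Φ : forall (ξ : Shv K Ω) (μ ν : CoShv Ω A),
      @mor K (Ban K) (mor (Int ξ μ) ν) (mor ξ (Hom μ ν)),
    [/\ forall ξ μ ν, isometric_iso (Φ ξ μ ν),
        forall ξ ξ' μ ν (α : mor ξ' ξ) (f : mor (Int ξ μ) ν),
          bapply (Φ ξ' μ ν)
            (f ∘ (indefinite_integral_map T r (J μ) α
                    : mor (Int ξ' μ) (Int ξ μ)))
          = bapply (Φ ξ μ ν) f ∘ α,
        forall ξ μ ν ν' (β : mor ν ν') (f : mor (Int ξ μ) ν),
          bapply (Φ ξ μ ν') (β ∘ f)
          = (hom_presheaf_map (idm μ) β : mor (Hom μ ν) (Hom μ ν'))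
              ∘ bapply (Φ ξ μ ν) f,
        forall μ μ' (γ : mor μ' μ), exists t : bnat (J μ') (J μ),
          integral_map γ t &
        forall ξ μ μ' ν (γ : mor μ' μ) (t : bnat (J μ') (J μ))
            (f : mor (Int ξ μ) ν),
          integral_map γ t ->
          bapply (Φ ξ μ' ν)
            (f ∘ (indefinite_integral_trans T r ξ t
                    : mor (Int ξ μ') (Int ξ μ)))
          = (hom_presheaf_map γ (idm ν) : mor (Hom μ ν) (Hom μ' ν))
              ∘ bapply (Φ ξ μ ν) f].
Proof.
exists (fun ξ μ => indefinite_integral_cosheaf T (J μ) ξ).
exists (fun μ ν => hom_presheaf_sheaf (sval ν) (cosheaf_glues (svalP μ))).
exists (fun ξ μ ν => transposem T (J μ) ξ (sval ν)); split.
- by move=> ξ μ ν; exact: transposem_iso.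
- by move=> ξ ξ' μ ν α f; exact: transpose_natural_sheaf.
- by move=> ξ μ ν ν' β f; exact: transpose_natural_target.
- by move=> μ μ' γ; exact: integral_map_ex.
- by move=> ξ μ μ' ν γ t f; exact: transpose_natural_measure.
Qed.
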